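(* Let $\mathfrak{A}$ be a unital $C^*$-algebra and let $(\mathcal{H}, \pi)$ be a nonzero irreducible representation of $\mathfrak{A}$. Define $$Y_+ = \{(\Psi,\Omega) \in \mathbb{S}\mathcal{H} \times \mathbb{S}\mathcal{H} : \langle \Psi, \Omega\rangle \in (0,1]\},$$ equipped with the subspace topology. There exists a continuous map $\mathcal{U} : Y_+ \to \mathrm{U}(\mathfrak{A})$ such that $$\pi(\mathcal{U}(\Psi,\Omega))\Psi = \Omega \quad\text{and}\quad \|\mathbf{1} - \mathcal{U}(\Psi,\Omega)\| = \|\Psi - \Omega\|$$ for all $(\Psi,\Omega) \in Y_+$.
   Context: Hilbert spaces are complex with inner product linear in the second variable. $\mathbb{S}\mathcal{H} = \{x \in \mathcal{H} : \|x\| = 1\}$ is the unit sphere with the norm topology. $\mathrm{U}(\mathfrak{A})$ is the unitary group of $\mathfrak{A}$ with the norm topology and $\mathbf{1}$ is the unit of $\mathfrak{A}$. *)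

(* Defs.v *)
From HB Require Import structures.
From mathcomp Require Import all_boot all_order all_algebra.
From mathcomp Require Import all_classical all_reals all_analysis.
From mathcomp Require Import complex.

Set Implicit Arguments.
Unset Strict Implicit.
Unset Printing Implicit Defensive.

Import Order.TTheory GRing.Theory Num.Theory.
Import numFieldNormedType.Exports.

Local Open Scope classical_set_scope.
Local Open Scope ring_scope.
Local Open Scope complex_scope.

(* The norm of a normed module over R[i] takes its values in R[i]. In the
   partial order of R[i], x <= y (resp. x < y) holds iff y - x is a nonnegative
   (resp. positive) real, so norms are nonnegative reals. *)

(* Hierarchy-Builder rejects a join of the ring structures with the normed
   modules that are not numDomainTypes, so the multiplication and the unit are
   fields here and not those of an algType. The zero algebra is allowed. *)
HB.mixin Record isUnitalCStar (R : realType) A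
    of CompleteNormedModule R[i] A := {
  cstar_mul : A -> A -> A ;
  cstar_one : A ;
  star : A -> A ;
  cstar_mulA : associative cstar_mul ;
  cstar_mul1l : left_id cstar_one cstar_mul ;
  cstar_mul1r : right_id cstar_one cstar_mul ;
  cstar_mulDl : left_distributive cstar_mul +%R ;
  cstar_mulDr : right_distributive cstar_mul +%R ;
  cstar_mulZl : forall (c : R[i]) (a b : A),
    cstar_mul (c *: a) b = c *: cstar_mul a b ;
  cstar_mulZr : forall (c : R[i]) (a b : A),
    cstar_mul a (c *: b) = c *: cstar_mul a b ;
  starD : {morph star : a b / a + b} ;
  starZ : forall (c : R[i]) (a : A), star (c *: a) = c^* *: star a ;
  starM : forall a b : A, star (cstar_mul a b) = cstar_mul (star b) (star a) ;
  starK : involutive star ;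
  cstar_normM : forall a b : A, `|cstar_mul a b| <= `|a| * `|b| ;
  cstar_identity : forall a : A, `|cstar_mul (star a) a| = `|a| ^+ 2
}.

#[short(type="unitalCStarType")]
HB.structure Definition UnitalCStar (R : realType) :=
  { A of isUnitalCStar R A & CompleteNormedModule R[i] A }.

(* Linear in the second variable. Positivity and definiteness follow from
   inner_norm. *)
HB.mixin Record isHilbert (R : realType) H of CompleteNormedModule R[i] H := {
  inner : H -> H -> R[i] ;
  innerDr : forall x y z : H, inner x (y + z) = inner x y + inner x z ;
  innerZr : forall (c : R[i]) (x y : H), inner x (c *: y) = c * inner x y ;
  innerC : forall x y : H, inner y x = (inner x y)^* ;
  inner_norm : forall x : H, inner x x = `|x| ^+ 2
}.

#[short(type="hilbertType")]
HB.structure Definition Hilbert (R : realType) :=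
  { H of isHilbert R H & CompleteNormedModule R[i] H }.

Section defs.
Variable R : realType.
Implicit Types (A : unitalCStarType R) (H : hilbertType R).

Definition bounded_operator H (T : {linear H -> H}) : Prop :=
  exists M : R[i], forall x : H, `|T x| <= M * `|x|.

(* A *-homomorphism from A to the bounded operators on H. It need not map the unit to
   the identity. The field rep_star says that rep (star a) is the adjoint of
   rep a. *)
Record representation A H := Representation {
  rep :> A -> {linear H -> H} ;
  rep_bounded : forall a : A, bounded_operator (rep a) ;
  repD : forall (a b : A) (x : H), rep (a + b) x = rep a x + rep b x ;
  repZ : forall (c : R[i]) (a : A) (x : H), rep (c *: a) x = c *: rep a x ;
  repM : forall (a b : A) (x : H), rep (cstar_mul a b) x = rep a (rep b x) ;
  rep_star : forall (a : A) (x y : H),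
    inner (rep (star a) x) y = inner x (rep a y)
}.

Definition nonzero_rep A H (pi : representation A H) : Prop :=
  exists (a : A) (x : H), pi a x <> 0.

Definition irreducible_rep A H (pi : representation A H) : Prop :=
  forall V : set H, submod_closed [in V] -> closed V ->
    (forall (a : A) (x : H), V x -> V (pi a x)) ->
  V = [set 0] \/ V = setT.

Definition unitary_group A : set A :=
  [set u | cstar_mul (star u) u = cstar_one /\ cstar_mul u (star u) = cstar_one].

Definition unit_sphere H : set H := [set x | `|x| = 1].
Arguments unit_sphere : clear implicits.

Definition Yplus H : set (H * H) :=
  [set p | [/\ unit_sphere H p.1, unit_sphere H p.2 & 0 < inner p.1 p.2 <= 1]].

End defs.
Arguments unitary_group {R} A.
Arguments Yplus {R} H.

(* Main.v *)
Require Import Defs.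
From mathcomp Require Import all_boot all_order all_algebra.
From mathcomp Require Import all_classical all_reals all_analysis.
From mathcomp Require Import complex ring lra wochoice.
Import Order.TTheory GRing.Theory Num.Theory.
Import numFieldNormedType.Exports Normc.
Set Implicit Arguments.
Unset Strict Implicit.
Unset Printing Implicit Defensive.
Local Open Scope classical_set_scope.
Local Open Scope ring_scope.
Local Open Scope complex_scope.

(* For orthonormal u, w in H, let C(u, w) be the set of self-adjoint c in A with
   c u = u and c w = - w. If m and d are the normalized sum and difference of
   (Psi, Omega) and u, w = (m -+ i d)/sqrt 2, then cutting c down to [-1, 1] by
   t |-> 2t/(1 + t^2) (which fixes 1 and -1, and is computed by a Cayley
   transform) and scaling by s = |Psi - Omega|/2 gives b with |b| <= s, and
   U = (sqrt(1 - b^2) + i b)^2 rotates Psi to Omega. Moreover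
   1 - U = - 2 i b (sqrt(1 - b^2) + i b) has norm at most 2 s, which also gives
   the continuity of U at the diagonal, where m, d cannot be chosen continuously.

   A continuous choice of c in C(u, w) is made as in Michael's theorem: a
   continuous approximate choice is improved by a small correction, chosen with a
   partition of unity, and the corrections are summed. The partition of unity is
   obtained from a well-order of A: if depth a x is the radius at x of the open
   set attached to a, then for each x only finitely many a have depth a x larger
   by a given amount than all earlier depths.

   Corrections of controlled norm exist because self-adjoint operators are
   approximated on finitely many vectors by self-adjoint elements of A. By an
   orthogonality argument this follows from the fact that the projection onto the
   closure of {(a e_i)_i | a in A} has scalar blocks (Schur's lemma), and the
   approximation of a rank-one projection is brought to norm 1 by the same
   function 2t/(1 + t^2). All square roots are limits of the iteration
   y |-> (x + y^2)/2, whose increments for |x| <= 1 are dominated by those of the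
   scalar iteration at x = 1. *)

(** * Linear combinations and real-valued norms *)

Local Notation iC := ('i%C) (only parsing).

(** Syntax for proving vector identities by reflection: [LVar i] is the atom at position i of a list
    of vectors, so that equal coefficients imply equal values. *)
Inductive lexp (K : Type) : Type :=
| LZero | LVar of nat | LAdd of lexp K & lexp K | LOpp of lexp K
| LScale of K & lexp K.
Arguments LZero {K}.
Arguments LVar {K}.

Fixpoint leval (K : pzRingType) (V : lmodType K) (vs : seq V) (e : lexp K) : V :=
  match e with
  | LZero => 0
  | LVar i => nth 0 vs i
  | LAdd e1 e2 => leval vs e1 + leval vs e2
  | LOpp e1 => - leval vs e1
  | LScale c e1 => c *: leval vs e1
  end.

Fixpoint lcoef (K : pzRingType) (e : lexp K) (i : nat) : K :=
  match e with
  | LZero => 0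
  | LVar j => if j == i then 1 else 0
  | LAdd e1 e2 => lcoef e1 i + lcoef e2 i
  | LOpp e1 => - lcoef e1 i
  | LScale c e1 => c * lcoef e1 i
  end.

Lemma leval_coef (K : pzRingType) (V : lmodType K) (vs : seq V) (e : lexp K) :
  leval vs e = \sum_(i < size vs) lcoef e i *: vs`_i.
Proof.
elim: e => [|j|e1 IH1 e2 IH2|e1 IH1|c e1 IH1] /=.
- by rewrite big1 // => i _; rewrite scale0r.
- have [jlt|jge] := ltnP j (size vs).
    rewrite (bigD1 (Ordinal jlt)) //= eqxx scale1r big1 ?addr0 // => i ij.
    rewrite ifN ?scale0r //; apply: contra ij => /eqP ij.
    by apply/eqP/val_inj.
  rewrite nth_default // big1 // => i _; rewrite ifN ?scale0r //.
  by rewrite neq_ltn (leq_trans (ltn_ord i) jge) orbT.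
- by rewrite IH1 IH2 -big_split; apply: eq_bigr => i _; rewrite scalerDl.
- by rewrite IH1 -sumrN; apply: eq_bigr => i _; rewrite scaleNr.
- by rewrite IH1 scaler_sumr; apply: eq_bigr => i _; rewrite scalerA.
Qed.

(** A recursive conjunction rather than a quantifier, so that simplification yields finitely many
    explicit scalar goals. *)
Fixpoint lcoef_eq (K : pzRingType) (n : nat) (e1 e2 : lexp K) : Prop :=
  if n is m.+1 then lcoef e1 m = lcoef e2 m /\ lcoef_eq m e1 e2 else True.

Lemma leval_eq (K : pzRingType) (V : lmodType K) (vs : seq V) (e1 e2 : lexp K) :
  lcoef_eq (size vs) e1 e2 -> leval vs e1 = leval vs e2.
Proof.
move=> h; rewrite !leval_coef; apply: eq_bigr => i _; congr (_ *: _).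
elim: (size vs) h (i : nat) (ltn_ord i) => // n IH [hn h] j.
by rewrite ltnS leq_eqVlt => /predU1P[->//|]; apply: IH.
Qed.

Ltac lmem x s :=
  match s with
  | nil => constr:(false)
  | ?y :: ?s' => match x with y => constr:(true) | _ => lmem x s' end
  end.

Ltac lfind x s :=
  match s with
  | ?y :: ?s' => match x with
      | y => constr:(0%N)
      | _ => let k := lfind x s' in constr:(S k) end
  end.

Ltac latoms s t :=
  match t with
  | @GRing.zero _ => s
  | @GRing.add _ ?a ?b => let s1 := latoms s a in latoms s1 b
  | @GRing.opp _ ?a => latoms s a
  | @GRing.scale _ _ _ ?a => latoms s a
  | _ => let b := lmem t s in
         match b with true => s | false => constr:(t :: s) end
  end.

Ltac lreify K s t :=
  match t with
  | @GRing.zero _ => constr:(@LZero K)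
  | @GRing.add _ ?a ?b =>
      let a' := lreify K s a in let b' := lreify K s b in
      constr:(@LAdd K a' b')
  | @GRing.opp _ ?a => let a' := lreify K s a in constr:(@LOpp K a')
  | @GRing.scale _ _ ?c ?a => let a' := lreify K s a in
      constr:(@LScale K c a')
  | _ => let k := lfind t s in constr:(@LVar K k)
  end.

(* Decides equations between linear combinations in a K-module, leaving one
   equation in K for each atom. *)
Ltac lmod_eq K :=
  match goal with
  | |- @eq ?V ?l ?r =>
    let s0 := latoms (@nil V) l in
    let s := latoms s0 r in
    let l' := lreify K s l in let r' := lreify K s r in
    apply: (@leval_eq K _ s l' r'); rewrite /=;
    repeat match goal with |- _ /\ _ => split | |- True => exact I end
  end.
Ltac lmod :=
  match goal with |- @eq ?V _ _ =>
    let W := constr:(V : lmodType _) in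
    match type of W with GRing.Lmodule.type ?K => lmod_eq K end
  end; first [by ring | by field].

Section real_norm.
Variable R : realType.

(** The order of [R[i]] is only partial; a real-valued norm makes estimates accessible to [lra] and
    [nra]. *)
Definition rn (E : normedModType R[i]) (x : E) : R := complex.Re `|x|.

Section basics.
Variable E : normedModType R[i].
Implicit Types x y z : E.

Lemma rnE x : `|x| = (rn x)%:C.
Proof. by rewrite /rn; have := ger0_Im (normr_ge0 x); case: `|x| => a b /= ->. Qed.

Lemma rn_ge0 x : 0 <= rn x.
Proof. by rewrite -ler0c -rnE normr_ge0. Qed.

Lemma rnD x y : rn (x + y) <= rn x + rn y.
Proof. by rewrite -lecR rmorphD /= -!rnE ler_normD. Qed.

Lemma rnN x : rn (- x) = rn x.
Proof. by rewrite /rn normrN. Qed.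

Lemma rnB x y : rn (x - y) <= rn x + rn y.
Proof. by rewrite -(rnN y) rnD. Qed.

Lemma rn_dist x y : rn (x - y) = rn (y - x).
Proof. by rewrite -rnN opprB. Qed.

Lemma rn_dist_trans y x z : rn (x - z) <= rn (x - y) + rn (y - z).
Proof. by rewrite -[x - z](subrKA y) rnD. Qed.

Lemma rn0 : rn (0 : E) = 0.
Proof. by rewrite /rn normr0. Qed.

Lemma rn_eq0 x : rn x = 0 -> x = 0.
Proof. by move=> h; apply/eqP; rewrite -normr_eq0 rnE h. Qed.

Lemma rn_gt0 x : x <> 0 -> 0 < rn x.
Proof. by move=> h; rewrite lt_def rn_ge0 andbT; apply/eqP => /rn_eq0. Qed.

Lemma rnZ (c : R[i]) x : rn (c *: x) = normc c * rn x.
Proof. by apply: complexI; rewrite -rnE normrZ rnE rmorphM; case: c. Qed.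

Lemma rn_le_eps x y : (forall e : R, 0 < e -> rn (x - y) < e) -> x = y.
Proof.
move=> h; apply/eqP; rewrite -subr_eq0; apply/eqP/rn_eq0/eqP.
rewrite eq_le rn_ge0 andbT; apply/ler_addgt0Pr => e e0.
by rewrite add0r ltW // h.
Qed.

End basics.

Lemma normc_real (r : R) : normc r%:C = `|r|.
Proof. by rewrite /= expr0n addr0 sqrtr_sqr. Qed.

Lemma normc_i : normc (iC : R[i]) = 1.
Proof. by rewrite /= expr0n add0r expr1n sqrtr1. Qed.

Definition rlim (E : normedModType R[i]) (u : nat -> E) (l : E) : Prop :=
  forall e : R, 0 < e -> exists N, forall n, (N <= n)%N -> rn (u n - l) < e.

Lemma rlim_unique (E : normedModType R[i]) (u : nat -> E) (l l' : E) :
  rlim u l -> rlim u l' -> l = l'.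
Proof.
move=> h h'; apply: rn_le_eps => e e0.
have e2 : 0 < e / 2 by lra.
have [N hN] := h _ e2; have [N' hN'] := h' _ e2.
have := hN (maxn N N') (leq_maxl _ _); have := hN' (maxn N N') (leq_maxr _ _).
have := rn_dist_trans (u (maxn N N')) l l'; rewrite (rn_dist l (u _)).
lra.
Qed.

Lemma rlim_map (E F : normedModType R[i]) (f : E -> F) (C : R) (u : nat -> E) l :
  (forall x y, rn (f x - f y) <= C * rn (x - y)) ->
  rlim u l -> rlim (f \o u) (f l).
Proof.
move=> fC h e e0.
have C0 : 0 < `|C| + 1 by rewrite ltr_wpDl.
have [N hN] := h _ (divr_gt0 e0 C0).
exists N => n /hN {}hN /=; apply: le_lt_trans (fC _ _) _.
rewrite ltr_pdivlMr // in hN; apply: le_lt_trans hN.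
rewrite mulrC ler_wpM2l ?rn_ge0 //.
by rewrite (le_trans (ler_norm C)) // lerDl.
Qed.

Lemma rlim_le (E : normedModType R[i]) (u : nat -> E) l (C : R) :
  (forall n, rn (u n) <= C) -> rlim u l -> rn l <= C.
Proof.
move=> hC h; apply/ler_addgt0Pr => e e0.
have [N /(_ N (leqnn N)) hN] := h _ e0.
have := hC N; have := rnD (u N) (l - u N); rewrite addrC subrK rn_dist.
lra.
Qed.

Lemma rlim_shift (E : normedModType R[i]) (u : nat -> E) l :
  rlim u l -> rlim (fun n => u n.+1) l.
Proof.
by move=> h e /h [N hN]; exists N => n /leqW; exact: hN.
Qed.

Lemma rlim_cauchy (E : completeNormedModType R[i]) (u : nat -> E) :
  (forall e : R, 0 < e -> exists N, forall n m, (N <= n)%N -> (N <= m)%N ->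
     rn (u n - u m) < e) ->
  exists l, rlim u l.
Proof.
move=> h.
have /cauchy_cvgP hc : cauchy (u @ \oo).
  apply/cauchy_ballP => e e0.
  have e0' : 0 < complex.Re e by move: e0; rewrite ltcE => /andP[].
  have [N hN] := h _ e0'.
  exists ([set x | exists2 n, (N <= n)%N & u n = x],
          [set x | exists2 n, (N <= n)%N & u n = x]) => /=.
    by split; exists N => // n /= Nn; exists n.
  move=> [a b] /= [[n Nn <-] [m Nm <-]].
  rewrite -ball_normE /ball_ /=.
  rewrite rnE.
  move: e0; rewrite !ltcE /= => /andP[/eqP -> _]; rewrite eqxx /=.
  exact: hN.
exists (lim (u @ \oo)) => e e0.
move/cvgrPdist_lt: hc => /(_ e%:C).
rewrite ltcR => /(_ e0) [N _ hN]; exists N => n /hN /=.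
by rewrite rnE ltcR rn_dist.
Qed.

(** The scalar sequence [s] is nondecreasing and bounded, so it comes arbitrarily close to its
    supremum, and its differences dominate all distances between terms of [u]. *)
Lemma rlim_increments (E : completeNormedModType R[i]) (u : nat -> E)
    (s : nat -> R) (M : R) :
  (forall n, rn (u n.+1 - u n) <= s n.+1 - s n) -> (forall n, s n <= M) ->
  exists l, rlim u l.
Proof.
move=> h sM.
have sn n : s n <= s n.+1.
  by rewrite -subr_ge0; apply: le_trans (h n); exact: rn_ge0.
have smono m n : (m <= n)%N -> s m <= s n.
  by move=> /subnK <-; elim: (n - m)%N => // k IH; apply: le_trans IH (sn _).
have hs m n : (m <= n)%N -> rn (u n - u m) <= s n - s m.
  move=> /subnK <-; elim: (n - m)%N => [|k IH]; first by rewrite !subrr rn0.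
  have := rn_dist_trans (u (k + m)%N) (u (k.+1 + m)%N) (u m).
  have := h (k + m)%N; rewrite -addSn; lra.
apply: rlim_cauchy => e e0.
have hsup : has_sup (range s).
  by split; [exists (s 0%N), 0%N|exists M => _ [n _ <-]].
have [_ [N _ <-] hN] := sup_adherent e0 hsup.
have ub n : s n <= sup (range s) by apply: ub_le_sup; [case: hsup|exists n].
exists N => n m Nn Nm.
wlog nm : n m Nn Nm / (n <= m)%N.
  by move=> w; case: (leqP n m) => [|/ltnW] ?; [|rewrite rn_dist]; exact: w.
rewrite rn_dist; apply: le_lt_trans (hs _ _ nm) _.
have := ub m; have := smono _ _ Nn; lra.
Qed.

Lemma rlim_increments_bound (E : normedModType R[i]) (u : nat -> E)
    (s : nat -> R) (M : R) l :
  (forall n, rn (u n.+1 - u n) <= s n.+1 - s n) -> (forall n, s n <= M) ->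
  rlim u l -> forall n, rn (l - u n) <= M - s n.
Proof.
move=> h sM ul n.
have hs k : rn (u (k + n)%N - u n) <= s (k + n)%N - s n.
  elim: k => [|k IH]; first by rewrite !subrr rn0.
  have := rn_dist_trans (u (k + n)%N) (u (k.+1 + n)%N) (u n).
  have := h (k + n)%N; rewrite -addSn; lra.
apply/ler_addgt0Pr => e e0; have [N hN] := ul _ e0.
have := hN (N + n)%N (leq_addr _ _); have := hs N; have := sM (N + n)%N.
have := rn_dist_trans (u (N + n)%N) l (u n); rewrite (rn_dist l (u (N + n)%N)); lra.
Qed.

End real_norm.

(** * Square roots of contractions *)

Section operator_square_root.
Variable R : realType.

Lemma rlimD (E : normedModType R[i]) (u v : nat -> E) (l m : E) :
  rlim u l -> rlim v m -> rlim (fun n => u n + v n) (l + m).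
Proof.
move=> hu hv e e0; have e2 : 0 < e / 2 by lra.
have [N hN] := hu _ e2; have [M hM] := hv _ e2.
exists (maxn N M) => n; rewrite geq_max => /andP[/hN + /hM].
have := rnD (u n - l) (v n - m); rewrite addrACA -opprD; lra.
Qed.

(** A predicate on plain functions, since the operators below are pointwise limits obtained by
    choice. *)
Definition additive_map (E F : zmodType) (f : E -> F) : Prop :=
  {morph f : x y / x + y}.

Lemma additive_map0 (E F : zmodType) (f : E -> F) : additive_map f -> f 0 = 0.
Proof. by move=> fD; apply: (addrI (f 0)); rewrite -fD !addr0. Qed.

Lemma additive_mapN (E F : zmodType) (f : E -> F) :
  additive_map f -> {morph f : x / - x}.
Proof.
by move=> fD x; apply: (addrI (f x)); rewrite -fD !subrr additive_map0.
Qed.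

Lemma additive_mapB (E F : zmodType) (f : E -> F) :
  additive_map f -> {morph f : x y / x - y}.
Proof. by move=> fD x y; rewrite fD additive_mapN. Qed.

Lemma additive_map_half (E F : lmodType R[i]) (f : E -> F) (x : E) :
  additive_map f -> f (2^-1 *: x) = 2^-1 *: f x.
Proof.
move=> fD; have -> : f x = f (2^-1 *: x) + f (2^-1 *: x).
  by rewrite -fD; congr f; lmod.
lmod.
Qed.

Lemma rlim_op (E F : normedModType R[i]) (f : E -> F) (C : R)
    (u : nat -> E) (l : E) :
  additive_map f -> (forall x, rn (f x) <= C * rn x) ->
  rlim u l -> rlim (fun n => f (u n)) (f l).
Proof.
by move=> fD fC; apply: (rlim_map (C := C)) => x y; rewrite -additive_mapB.
Qed.

Fixpoint sqrt_bound (n : nat) : R :=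
  if n is m.+1 then (1 + sqrt_bound m ^+ 2) / 2 else 0.

Lemma sqrt_bound_ge0 n : 0 <= sqrt_bound n.
Proof. by case: n => //= n; have := sqr_ge0 (sqrt_bound n); lra. Qed.

Lemma sqrt_bound_le1 n : sqrt_bound n <= 1.
Proof. by elim: n => [|n IH] /=; [lra|have := sqrt_bound_ge0 n; nra]. Qed.

Lemma sqrt_bound_le n : sqrt_bound n <= sqrt_bound n.+1.
Proof. by rewrite /=; have := sqr_ge0 (sqrt_bound n - 1); nra. Qed.

Variables (E : completeNormedModType R[i]) (X : E -> E).

(* The iteration y |-> (x + y^2)/2 for the fixed point y = 1 - sqrt(1 - x). *)
Fixpoint sqrt_iter (n : nat) (v : E) : E :=
  if n is m.+1 then 2^-1 *: (X v + sqrt_iter m (sqrt_iter m v)) else 0.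

Hypothesis XD : additive_map X.

Lemma sqrt_iter_additive n : additive_map (sqrt_iter n).
Proof.
elim: n => [|n IH] x y /=; first by rewrite addr0.
rewrite XD !IH; lmod.
Qed.

Lemma sqrt_iter_comm (Z : E -> E) : additive_map Z ->
  (forall v, Z (X v) = X (Z v)) ->
  forall n v, Z (sqrt_iter n v) = sqrt_iter n (Z v).
Proof.
move=> ZD ZX; elim=> [|n IH] v /=; first exact: additive_map0.
by rewrite additive_map_half// ZD ZX !IH.
Qed.

Hypothesis Xle : forall v, rn (X v) <= rn v.

Lemma half_norm (v : E) : rn (2^-1 *: v) = rn v / 2.
Proof.
have -> : 2^-1 = (2^-1 : R)%:C by rewrite rmorphV ?unitfE// rmorph_nat.
by rewrite rnZ normc_real ger0_norm ?invr_ge0// mulrC.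
Qed.

Lemma sqrt_iter_le n v : rn (sqrt_iter n v) <= sqrt_bound n * rn v.
Proof.
elim: n v => [|n IH] v /=; first by rewrite rn0 mul0r.
rewrite half_norm.
have := rnD (X v) (sqrt_iter n (sqrt_iter n v)).
have := IH (sqrt_iter n v); have := IH v; have := Xle v.
have := sqrt_bound_ge0 n; have := rn_ge0 v; nra.
Qed.

(** With y and y' consecutive iterates, y' y' - y y = y' (y' - y) + (y' - y) y. The increments of
    [sqrt_bound] satisfy the same recursion with equality. *)
Lemma sqrt_iter_incr n v :
  rn (sqrt_iter n.+1 v - sqrt_iter n v) <=
  (sqrt_bound n.+1 - sqrt_bound n) * rn v.
Proof.
elim: n v => [|n IH] v.
  rewrite /= !addr0 subr0 half_norm.
  by have := Xle v; have := rn_ge0 v; lra.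
set Y1 := sqrt_iter n.+1; set Y0 := sqrt_iter n.
have -> : sqrt_iter n.+2 v - Y1 v =
    2^-1 *: (Y1 (Y1 v - Y0 v) + (Y1 (Y0 v) - Y0 (Y0 v))).
  rewrite [Y1 (_ - _)]additive_mapB; last exact: sqrt_iter_additive.
  have -> : sqrt_iter n.+2 v = 2^-1 *: (X v + Y1 (Y1 v)) by [].
  have e1 : Y1 v = 2^-1 *: (X v + Y0 (Y0 v)) by [].
  rewrite [X in _ - X = _]e1.
  lmod.
rewrite half_norm.
have h1 := sqrt_iter_le n.+1 (Y1 v - Y0 v).
have h2 := IH v; have h3 := IH (Y0 v); have h4 := sqrt_iter_le n v.
have h5 := rnD (Y1 (Y1 v - Y0 v)) (Y1 (Y0 v) - Y0 (Y0 v)).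
have t0 := sqrt_bound_ge0 n; have t1 := sqrt_bound_ge0 n.+1.
have t01 := sqrt_bound_le n.
have -> : sqrt_bound n.+2 - sqrt_bound n.+1 =
   (sqrt_bound n.+1 * (sqrt_bound n.+1 - sqrt_bound n) +
    (sqrt_bound n.+1 - sqrt_bound n) * sqrt_bound n) / 2.
  by rewrite [in LHS]/= -/(sqrt_bound n.+1) [in X in _ - X]/=; field.
rewrite -/Y1 -/Y0 in h1 h2 h3 h4.
have := ler_wpM2l t1 h2.
have := ler_wpM2l (_ : 0 <= sqrt_bound n.+1 - sqrt_bound n) h4.
rewrite subr_ge0 => /(_ t01); lra.
Qed.

Lemma sqrt_iter_lim : exists Y : E -> E,
  forall v, rlim (fun n => sqrt_iter n v) (Y v).
Proof.
suff h v : exists y, rlim (fun n => sqrt_iter n v) y.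
  by exists (fun v => sval (cid (h v))) => v; case: cid.
apply: (rlim_increments (s := fun n => sqrt_bound n * rn v) (M := rn v)) => n.
  by rewrite -mulrBl; exact: sqrt_iter_incr.
by rewrite ler_piMl ?rn_ge0 ?sqrt_bound_le1.
Qed.

Lemma sqrt_iter_contr n v : rn (sqrt_iter n v) <= 1 * rn v.
Proof.
apply: le_trans (sqrt_iter_le _ _) _.
by rewrite ler_wpM2r ?rn_ge0 ?sqrt_bound_le1.
Qed.

Variable Y : E -> E.
Hypothesis hY : forall v, rlim (fun n => sqrt_iter n v) (Y v).

Lemma sqrt_op_additive : additive_map Y.
Proof.
move=> x y; apply: (rlim_unique (hY _)).
have := rlimD (hY x) (hY y); congr rlim; apply/funext => n.
by rewrite sqrt_iter_additive.
Qed.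

Lemma sqrt_op_le v : rn (Y v) <= rn v.
Proof.
apply: rlim_le (hY v) => n; rewrite -[leRHS]mul1r; exact: sqrt_iter_contr.
Qed.

Lemma sqrt_op_eq v : Y v = 2^-1 *: (X v + Y (Y v)).
Proof.
apply: (rlim_unique (rlim_shift (hY v))) => e e0.
have e2 : 0 < e / 2 by lra.
have [N hN] := hY v e2; have [M hM] := hY (Y v) e2.
exists (maxn N M) => n; rewrite geq_max => /andP[/hN h1 /hM h2] /=.
rewrite -scalerBr half_norm opprD addrACA subrr add0r.
have := sqrt_iter_contr n (sqrt_iter n v - Y v).
rewrite additive_mapB; last exact: sqrt_iter_additive.
have := rn_dist_trans (sqrt_iter n (Y v)) (sqrt_iter n (sqrt_iter n v)) (Y (Y v)).
have := rn_ge0 (sqrt_iter n (sqrt_iter n v) - Y (Y v)).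
lra.
Qed.

(** Commutation with [X] passes to every iterate, and boundedness of [Z] carries it to the limit. It
    is applied to multiplications in the algebra, to scalars, and to operators [pi a]. *)
Lemma sqrt_op_comm (Z : E -> E) (C : R) : additive_map Z ->
  (forall v, rn (Z v) <= C * rn v) -> (forall v, Z (X v) = X (Z v)) ->
  forall v, Z (Y v) = Y (Z v).
Proof.
move=> ZD ZC ZX v; have := rlim_op ZD ZC (hY v).
have -> : (fun n => Z (sqrt_iter n v)) = fun n => sqrt_iter n (Z v).
  by apply/funext => n; rewrite sqrt_iter_comm.
by move=> h; exact: rlim_unique h (hY _).
Qed.

End operator_square_root.

(** * Functional calculus in a C*-algebra *)

Section cstar_calculus.
Variables (R : realType) (A : unitalCStarType R).
Implicit Types a b c x y z g : A.
Local Notation "a ** b" := (cstar_mul a b) (at level 40, left associativity).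
Local Notation e1 := (cstar_one : A).

Lemma cmul_additivel b : additive_map (fun a => a ** b).
Proof. by move=> x y; rewrite cstar_mulDl. Qed.

Lemma cmul_additiver a : additive_map (cstar_mul a).
Proof. by move=> x y; rewrite cstar_mulDr. Qed.

Lemma cmulNl a b : (- a) ** b = - (a ** b).
Proof. exact: (additive_mapN (cmul_additivel b)). Qed.

Lemma cmulNr a b : a ** (- b) = - (a ** b).
Proof. exact: (additive_mapN (cmul_additiver a)). Qed.

Lemma star_additive : additive_map (star : A -> A).
Proof. by move=> x y; rewrite starD. Qed.

Lemma starN a : star (- a) = - star a.
Proof. exact: (additive_mapN star_additive). Qed.

Lemma star1 : star e1 = e1.
Proof.
by rewrite -[LHS]cstar_mul1r -{2}(starK e1) -starM cstar_mul1r starK.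
Qed.

Lemma starZc (c : R[i]) a : star (c *: a) = conjc c *: star a.
Proof. exact: starZ. Qed.

Definition cmulE := (@cstar_mulDl _ A, @cstar_mulDr _ A, cmulNl, cmulNr,
  @cstar_mulZl _ A, @cstar_mulZr _ A, @cstar_mul1l _ A, @cstar_mul1r _ A).

Definition starE := (@starD _ A, starN, starZc, @starM _ A, star1).

Lemma rn_cmul a b : rn (a ** b) <= rn a * rn b.
Proof. by rewrite -lecR rmorphM /= -!rnE cstar_normM. Qed.

Lemma rn_cstar a : rn (star a ** a) = rn a ^+ 2.
Proof. by apply: complexI; rewrite -rnE cstar_identity rnE rmorphXn. Qed.

Lemma rn_star a : rn (star a) = rn a.
Proof.
suff h b : rn b <= rn (star b) by apply/eqP; rewrite eq_le -{2}(starK a) !h.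
have [->|/eqP/rn_gt0 b0] := eqVneq b 0; first by rewrite rn0 rn_ge0.
by rewrite -(ler_pM2r b0) -expr2 -rn_cstar rn_cmul.
Qed.

(** The C*-identity gives |1| = |1|^2. Only an inequality holds in general, because the unit of the
    zero algebra has norm 0. *)
Lemma rn_one_le1 : rn e1 <= 1.
Proof.
have := rn_cstar e1; rewrite star1 cstar_mul1l expr2.
by have := rn_ge0 e1; nra.
Qed.

Lemma rn_isometry a : star a ** a = e1 -> rn a <= 1.
Proof.
move=> h; have := rn_cstar a; rewrite h => h2.
by have := rn_one_le1; have := rn_ge0 a; nra.
Qed.

(** The element 1 - sqrt(1 - x), obtained by applying the operator iteration to the unit; the
    default 0 is taken only when there is no limit. *)
Definition sqrt1m_defect x : A :=
  xget 0 [set l | rlim (fun n => sqrt_iter (cstar_mul x) n e1) l].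

(* The square root of 1 - x, for x of norm at most 1. *)
Definition sqrt1m x : A := e1 - sqrt1m_defect x.

(** Right multiplications commute with left multiplication by [x], hence with the iterates, which
    are therefore themselves left multiplications. *)
Lemma sqrt_iter_cmul x n v :
  sqrt_iter (cstar_mul x) n v = sqrt_iter (cstar_mul x) n e1 ** v.
Proof.
have := sqrt_iter_comm (cmul_additivel v) _ n e1.
move/(_ (cstar_mul x)) => -> /=; first by rewrite cstar_mul1l.
by move=> w; rewrite cstar_mulA.
Qed.

Lemma rn_cmull_le x : rn x <= 1 -> forall v, rn (x ** v) <= rn v.
Proof.
move=> x1 v; apply: le_trans (rn_cmul _ _) _.
by rewrite ler_piMl ?rn_ge0.
Qed.

Lemma sqrt1m_defect_lim x : rn x <= 1 ->
  rlim (fun n => sqrt_iter (cstar_mul x) n e1) (sqrt1m_defect x).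
Proof.
move=> x1; have [Y hY] := sqrt_iter_lim (cmul_additiver x) (rn_cmull_le x1).
rewrite /sqrt1m_defect; case: xgetP => [l _ //|/(_ (Y e1))].
by case; exact: hY.
Qed.

Lemma sqrt1m_defectE x : rn x <= 1 ->
  [/\ sqrt1m_defect x = 2^-1 *: (x + sqrt1m_defect x ** sqrt1m_defect x),
      rn (sqrt1m_defect x) <= 1 &
      forall z, z ** x = x ** z ->
        z ** sqrt1m_defect x = sqrt1m_defect x ** z].
Proof.
move=> x1; set y := sqrt1m_defect x.
have XD := cmul_additiver x; have Xle := rn_cmull_le x1.
have [Y hY] := sqrt_iter_lim XD Xle.
have yE : y = Y e1 by apply: rlim_unique (sqrt1m_defect_lim x1) (hY e1).
have YE v : y ** v = Y v.
  rewrite yE -[v in RHS]cstar_mul1l.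
  apply: (sqrt_op_comm hY (C := rn v) (cmul_additivel v) _ _ e1) => w.
    by rewrite mulrC rn_cmul.
  by rewrite cstar_mulA.
split.
- by rewrite {1}yE (sqrt_op_eq XD Xle hY) cstar_mul1r -yE -YE.
- by rewrite yE (le_trans (sqrt_op_le Xle hY _)) ?rn_one_le1.
move=> z zx; rewrite YE yE -[z in RHS]cstar_mul1r.
apply: (sqrt_op_comm hY (C := rn z) (cmul_additiver z) _ _ e1) => w.
  exact: rn_cmul.
by rewrite !cstar_mulA zx.
Qed.

Lemma sqrt1mE x : rn x <= 1 -> sqrt1m x ** sqrt1m x = e1 - x.
Proof.
move=> /sqrt1m_defectE[yE _ _]; rewrite /sqrt1m !cmulE.
set y := sqrt1m_defect x in yE *.
have -> : y ** y = 2 *: y - x by rewrite [y in _ *: y]yE; lmod.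
lmod.
Qed.

Lemma sqrt1m_comm x z : rn x <= 1 ->
  z ** x = x ** z -> z ** sqrt1m x = sqrt1m x ** z.
Proof.
move=> x1 zx; have [_ _ /(_ z zx) comm] := sqrt1m_defectE x1.
by rewrite /sqrt1m !cmulE comm.
Qed.

Lemma sqrt1m_dist1 x : rn x <= 1 -> rn (e1 - sqrt1m x) <= 1.
Proof. by move=> x1; have [_ h _] := sqrt1m_defectE x1; rewrite /sqrt1m subKr. Qed.

Lemma sqrt1m_star x : rn x <= 1 -> star x = x -> star (sqrt1m x) = sqrt1m x.
Proof.
move=> x1 xs; rewrite /sqrt1m !starE; congr (_ - _).
have h := sqrt1m_defect_lim x1.
have sC a : rn (star a) <= 1 * rn a by rewrite mul1r rn_star.
apply: (rlim_unique _ h); have := rlim_op star_additive sC h.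
congr (rlim _ _); apply/funext; elim=> [|n IH] /=.
  exact: additive_map0 star_additive.
rewrite sqrt_iter_cmul (additive_map_half _ star_additive) !starE IH.
by rewrite !cmulE xs.
Qed.

(** The square root is not Lipschitz up to |x| = 1. For |x| <= 1/2 the defects y, y' have norm at
    most 1/2, and y - y' = ((x - x') + y (y - y') + (y - y') y')/2 lets half of |y - y'| be
    absorbed. *)
Lemma sqrt1m_lipschitz x x' : rn x <= 1 / 2 -> rn x' <= 1 / 2 ->
  rn (sqrt1m x - sqrt1m x') <= rn (x - x').
Proof.
have yle u : rn u <= 1 / 2 -> rn (sqrt1m_defect u) <= 1 / 2.
  move=> u2; have u1 : rn u <= 1 by lra.
  apply: rlim_le (sqrt1m_defect_lim u1); elim=> [|n IH] /=.
    by rewrite rn0; lra.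
  rewrite half_norm sqrt_iter_cmul cstar_mul1r.
  set w := sqrt_iter _ n e1 in IH *.
  have := rnD u (w ** w); have := rn_cmul w w.
  have := rn_ge0 w; nra.
move=> hx hx'; have y1 := yle _ hx; have y2 := yle _ hx'.
have x1 : rn x <= 1 by lra.
have x1' : rn x' <= 1 by lra.
have [e _ _] := sqrt1m_defectE x1; have [e' _ _] := sqrt1m_defectE x1'.
rewrite /sqrt1m.
set y := sqrt1m_defect x in e y1 *; set y' := sqrt1m_defect x' in e' y2 *.
have d : y - y' = 2^-1 *: ((x - x') + (y ** (y - y') + (y - y') ** y')).
  by rewrite [X in X - _ = _]e [X in _ - X = _]e' !cmulE; lmod.
have -> : e1 - y - (e1 - y') = - (y - y') by lmod.
rewrite rnN; have := congr1 (@rn _ _) d; rewrite half_norm => dn.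
have := rnD (x - x') (y ** (y - y') + (y - y') ** y').
have := rnD (y ** (y - y')) ((y - y') ** y').
have := rn_cmul y (y - y'); have := rn_cmul (y - y') y'.
have := rn_ge0 (y - y'); have := rn_ge0 y; have := rn_ge0 y'; nra.
Qed.

Lemma rn_sqr_selfadjoint b : star b = b -> rn (b ** b) = rn b ^+ 2.
Proof. by move=> bs; rewrite -{1}bs rn_cstar. Qed.

Lemma conjc_i : conjc (iC : R[i]) = - iC.
Proof. by apply/eqP; rewrite eq_complex /= oppr0 !eqxx. Qed.

Lemma conjc_Ni : conjc (- iC : R[i]) = iC.
Proof. by rewrite -conjc_i conjcK. Qed.

Lemma half_angle_unitary b : star b = b -> rn b <= 1 ->
  star (sqrt1m (b ** b) + iC *: b) ** (sqrt1m (b ** b) + iC *: b) = e1 /\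
  (sqrt1m (b ** b) + iC *: b) ** star (sqrt1m (b ** b) + iC *: b) = e1.
Proof.
move=> bs b1; have bb1 : rn (b ** b) <= 1.
  by rewrite rn_sqr_selfadjoint // expr_le1 ?rn_ge0.
have bbs : star (b ** b) = b ** b by rewrite starM bs.
have rs := sqrt1m_star bb1 bbs; have rr := sqrt1mE bb1.
have rb := sqrt1m_comm bb1 (cstar_mulA b b b).
move: (sqrt1m _) rs rr rb => r rs rr rb.
rewrite !starE rs bs conjc_i !cmulE rr rb.
by split; lmod_eq R[i]; ring: (sqr_i R).
Qed.

Lemma rn_of_average a u v : rn u <= 1 -> rn v <= 1 -> 2 *: a = u + v ->
  rn a <= 1.
Proof.
move=> u1 v1 h; have -> : a = 2^-1 *: (u + v) by rewrite -h; lmod.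
by rewrite half_norm; have := rnD u v; lra.
Qed.

(** The root is the average of the unitary sqrt(1 - b^2) + i b and its adjoint. *)
Lemma rn_sqrt1m b : star b = b -> rn b <= 1 -> rn (sqrt1m (b ** b)) <= 1.
Proof.
move=> bs b1; have bb1 : rn (b ** b) <= 1.
  by rewrite rn_sqr_selfadjoint // expr_le1 ?rn_ge0.
have [h _] := half_angle_unitary bs b1.
have h1 := rn_isometry h; have h2 := h1; rewrite -rn_star in h2; apply: (rn_of_average h1 h2).

have bbs : star (b ** b) = b ** b by rewrite starM bs.
move: (sqrt1m _) (sqrt1m_star bb1 bbs) => r rs.
by rewrite !starE rs bs conjc_i; lmod.
Qed.

Lemma neumann x (q : R) : rn x <= 1 -> 0 <= q -> q < 1 -> exists k,
  (e1 - q%:C *: x) ** k = e1 /\ k ** (e1 - q%:C *: x) = e1.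
Proof.
move=> x1 q0 q1.
pose u := fix u n := if n is m.+1 then e1 + q%:C *: (x ** u m) else e1.
have q1' : 1 - q != 0 by rewrite subr_eq0 eq_sym lt_eqF.
(* The majorant is minus the tail of the geometric series: its increments are the powers of [q] and
   it is bounded by 0. *)
have [||k hk] := @rlim_increments R A u (fun n => - (q ^+ n.+1 / (1 - q))) 0.
- move=> n; have -> : - (q ^+ n.+2 / (1 - q)) - - (q ^+ n.+1 / (1 - q)) = q ^+ n.+1.
    by rewrite !exprS; field.
  elim: n => [|n IH].
    rewrite [u 1%N]/= cstar_mul1r [e1 + _]addrC addrK rnZ normc_real ger0_norm //.
    by rewrite expr1 ler_piMr.
  have -> : u n.+2 - u n.+1 = q%:C *: (x ** (u n.+1 - u n)).
    by rewrite [u n.+2]/= -/(u n.+1) [X in _ - X = _]/= !cmulE; lmod.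
  rewrite rnZ normc_real ger0_norm // exprS ler_wpM2l //.
  by apply: le_trans (rn_cmull_le x1 _) IH.
- by move=> n; rewrite oppr_le0 divr_ge0 ?exprn_ge0 // subr_ge0 ltW.
have comm n : u n ** x = x ** u n.
  elim: n => [|n IH] /=; first by rewrite cstar_mul1l cstar_mul1r.
  by rewrite !cmulE -cstar_mulA IH.
have kx : k ** x = x ** k.
  have h1 : rlim (fun n => u n ** x) (k ** x).
    apply: (rlim_op (C := rn x) (cmul_additivel x)) hk => v.
    by rewrite mulrC rn_cmul.
  have h2 : rlim (fun n => x ** u n) (x ** k).
    exact: (rlim_op (C := rn x) (cmul_additiver x) (rn_cmul x)) hk.
  by apply: rlim_unique h1 _; congr (rlim _ _): h2; apply/funext.
have kE : k = e1 + q%:C *: (x ** k).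
  apply: rlim_unique (rlim_shift hk) _ => /=.
  have f C : rlim (fun=> C) (C : A).
    by move=> e e0; exists 0%N => n _; rewrite subrr rn0.
  apply: rlimD (f e1) _.
  apply: (rlim_op (f := fun v => q%:C *: (x ** v)) (C := q * rn x)) hk.
    by move=> v w; rewrite !cmulE scalerDr.
  move=> v; rewrite rnZ normc_real ger0_norm // -mulrA ler_wpM2l //.
  exact: rn_cmul.
by exists k; rewrite !cmulE kx {1 3}kE; split; lmod.
Qed.

Lemma inverse_unique a g g' : g ** a = e1 -> a ** g' = e1 -> g = g'.
Proof. by move=> h h'; rewrite -[g]cstar_mul1r -h' cstar_mulA h cstar_mul1l. Qed.

(** With b = c/N of norm at most 1, x = 1 - b^2 is a contraction and 1 + c^2 = (1 + N^2)(1 - q x)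
    for q = N^2/(1 + N^2) < 1. The Neumann series inverts this, and 1 + c^2 = (1 - i c)(1 + i c)
    with commuting factors. *)
Lemma resolvent_exists c : star c = c -> exists g,
  (e1 - iC *: c) ** g = e1 /\ g ** (e1 - iC *: c) = e1.
Proof.
move=> cs; pose N : R := rn c + 1.
have N0 : 0 < N by rewrite ltr_wpDl ?rn_ge0.
pose b := (N^-1)%:C *: c.
have bs : star b = b by rewrite starZc cs conjc_real.
have b1 : rn b <= 1.
  rewrite rnZ normc_real gtr0_norm ?invr_gt0 // mulrC ler_pdivrMr // mul1r.
  by rewrite /N lerDl.
pose x := e1 - b ** b.
have x1 : rn x <= 1.
  have r1 := rn_sqrt1m bs b1; rewrite /x -sqrt1mE.
    by apply: le_trans (rn_cmul _ _) _; rewrite mulr_ile1 ?rn_ge0.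
  by rewrite rn_sqr_selfadjoint // expr_le1 ?rn_ge0.
pose q : R := N ^+ 2 / (1 + N ^+ 2).
have NN : 0 < N ^+ 2 by rewrite exprn_gt0.
have q0 : 0 <= q by rewrite divr_ge0 // ltW // ltr_wpDl.
have q1 : q < 1 by rewrite ltr_pdivrMr ?mul1r ?ltrDr ?ltr01 // ltr_wpDl.
have [k [k1 k2]] := neumann x1 q0 q1.
have cc : c ** c = (N ^+ 2)%:C *: (b ** b).
  rewrite /b !cmulE !scalerA -!rmorphM /=.
  have -> : N ^+ 2 * (N^-1 / N) = 1 by field; rewrite gt_eqF.
  by rewrite rmorph1 scale1r.
have E : e1 + c ** c = (1 + N ^+ 2)%:C *: (e1 - q%:C *: x).
  rewrite cc /x scalerBr scalerA -rmorphM /=.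
  have -> : (1 + N ^+ 2) * q = N ^+ 2 by rewrite /q; field; rewrite gt_eqF// ltr_wpDl // ltW.
  by rewrite rmorphD rmorph1; lmod.
have inv1 : ((1 + N ^+ 2)^-1)%:C * (1 + N ^+ 2)%:C = 1 :> R[i].
  by rewrite -rmorphM /= mulVf ?rmorph1 // gt_eqF // ltr_wpDl // ltW.
pose k' := ((1 + N ^+ 2)^-1)%:C *: k.
have k1' : (e1 + c ** c) ** k' = e1.
  by rewrite E cstar_mulZl cstar_mulZr scalerA mulrC inv1 scale1r k1.
have k2' : k' ** (e1 + c ** c) = e1.
  by rewrite E cstar_mulZl cstar_mulZr scalerA inv1 scale1r k2.
have F1 : (e1 - iC *: c) ** (e1 + iC *: c) = e1 + c ** c.
  by rewrite !cmulE; lmod_eq R[i]; ring: (sqr_i R).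
have F2 : (e1 + iC *: c) ** (e1 - iC *: c) = e1 + c ** c.
  by rewrite !cmulE; lmod_eq R[i]; ring: (sqr_i R).
have G1 : (e1 - iC *: c) ** ((e1 + iC *: c) ** k') = e1 by rewrite cstar_mulA F1.
have G2 : (k' ** (e1 + iC *: c)) ** (e1 - iC *: c) = e1 by rewrite -cstar_mulA F2.
by exists ((e1 + iC *: c) ** k'); rewrite -{2}(inverse_unique G2 G1).
Qed.

Definition resolvent c : A :=
  xget 0 [set g | (e1 - iC *: c) ** g = e1 /\ g ** (e1 - iC *: c) = e1].

Lemma resolventP c : star c = c ->
  (e1 - iC *: c) ** resolvent c = e1 /\ resolvent c ** (e1 - iC *: c) = e1.
Proof.
move=> /resolvent_exists[g hg]; rewrite /resolvent; case: xgetP => [? _ //|].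
by move/(_ g); case.
Qed.

Lemma resolvent_starP c : star c = c ->
  (e1 + iC *: c) ** star (resolvent c) = e1 /\
  star (resolvent c) ** (e1 + iC *: c) = e1.
Proof.
move=> cs; have [h1 h2] := resolventP cs.
have e : star (e1 - iC *: c) = e1 + iC *: c.
  by rewrite !starE cs conjc_i scaleNr opprK.
by split; rewrite -e -starM ?h1 ?h2 star1.
Qed.

(* 2g - 1 is the Cayley transform (1 + ic)(1 - ic)^-1. *)
Lemma cayley_isometry c : star c = c ->
  star (2 *: resolvent c - e1) ** (2 *: resolvent c - e1) = e1.
Proof.
move=> cs; have [h1 h2] := resolventP cs; have [h3 h4] := resolvent_starP cs.
set g := resolvent c in h1 h2 h3 h4 *.
have e : star g + g = 2 *: (star g ** g).
  have s1 : star g = star g ** ((e1 - iC *: c) ** g) by rewrite h1 cstar_mul1r.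
  have s2 : g = (star g ** (e1 + iC *: c)) ** g by rewrite h4 cstar_mul1l.
  by rewrite [X in X + _ = _]s1 [X in _ + X = _]s2 !cmulE !cstar_mulA; lmod.
have c2 : conjc (2 : R[i]) = 2 by rewrite rmorph_nat.
rewrite !starE c2 !cmulE.
have -> : star g ** g = 2^-1 *: (star g + g) by rewrite e; lmod.
lmod.
Qed.

(** The resolvent is the average of the Cayley transform and the unit. *)
Lemma rn_resolvent c : star c = c -> rn (resolvent c) <= 1.
Proof.
move=> cs; apply: rn_of_average (rn_isometry (cayley_isometry cs)) rn_one_le1 _.
lmod.
Qed.

(** The resolvent identity g - g' = g (i (c - c')) g' with two contractions as outer factors. *)
Lemma resolvent_lipschitz c c' : star c = c -> star c' = c' ->
  rn (resolvent c - resolvent c') <= rn (c - c').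
Proof.
move=> cs cs'; have [_ h] := resolventP cs; have [h' _] := resolventP cs'.
have -> : resolvent c - resolvent c' =
    resolvent c ** (iC *: (c - c') ** resolvent c').
  have -> : iC *: (c - c') = (e1 - iC *: c') - (e1 - iC *: c) by lmod.
  rewrite [(_ - _) ** _]cstar_mulDl h' cmulNl cstar_mulDr cmulNr cstar_mulA h.
  by rewrite cstar_mul1r cstar_mul1l.
apply: le_trans (rn_cmull_le (rn_resolvent cs) _) _.
apply: le_trans (rn_cmul _ _) _; rewrite rnZ normc_i mul1r.
by rewrite ler_piMr ?rn_ge0 ?rn_resolvent.
Qed.

(* The function t |-> 2 t / (1 + t^2) of c: it takes its values in [-1, 1] and
   fixes 0, 1 and -1. *)
Definition clamp c : A := - iC *: (resolvent c - star (resolvent c)).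

Lemma clamp_star c : star (clamp c) = clamp c.
Proof. by rewrite /clamp !starE starK conjc_Ni; lmod. Qed.

(** [clamp c] is the imaginary part of the Cayley transform of [c]. *)
Lemma rn_clamp c : star c = c -> rn (clamp c) <= 1.
Proof.
move=> cs; have h := rn_isometry (cayley_isometry cs).
have n1 (u : A) : rn u <= 1 -> rn (- iC *: u) <= 1.
  by rewrite rnZ normcN normc_i mul1r.
have h' := h; rewrite -rn_star -rnN in h'.
apply: (rn_of_average (n1 _ h) (n1 _ h')).
have c2 : conjc (2 : R[i]) = 2 by rewrite rmorph_nat.
by rewrite /clamp !starE c2; lmod.
Qed.

Lemma clamp_lipschitz c c' : star c = c -> star c' = c' ->
  rn (clamp c - clamp c') <= 2 * rn (c - c').
Proof.
move=> cs cs'; have h := resolvent_lipschitz cs cs'.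
have -> : clamp c - clamp c' = - iC *: ((resolvent c - resolvent c') -
    star (resolvent c - resolvent c')).
  by rewrite /clamp !starE; lmod.
rewrite rnZ normcN normc_i mul1r; apply: le_trans (rnB _ _) _.
by rewrite rn_star; lra.
Qed.

End cstar_calculus.

(** * Representations and Schur's lemma *)

Section conjugation.
Variable R : realType.

Lemma conjcD (a b : R[i]) : conjc (a + b) = conjc a + conjc b.
Proof. exact: rmorphD. Qed.

Lemma conjcM (a b : R[i]) : conjc (a * b) = conjc a * conjc b.
Proof. exact: rmorphM. Qed.

Lemma conjcN (a : R[i]) : conjc (- a) = - conjc a.
Proof. exact: rmorphN. Qed.

End conjugation.

(** * Geometry of the inner product *)

Section hilbert.
Variables (R : realType) (H : hilbertType R).
Implicit Types x y z : H.

Lemma innerDl x y z : inner (x + y) z = inner x z + inner y z :> R[i].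
Proof. by rewrite innerC innerDr conjcD -!innerC. Qed.

Lemma innerZl (c : R[i]) x y : inner (c *: x) y = conjc c * inner x y.
Proof. by rewrite innerC innerZr conjcM -innerC. Qed.

Lemma innerNr x y : inner x (- y) = - inner x y :> R[i].
Proof. by rewrite -scaleN1r innerZr mulN1r. Qed.

Lemma innerNl x y : inner (- x) y = - inner x y :> R[i].
Proof. by rewrite innerC innerNr conjcN -innerC. Qed.

Lemma inner0r x : inner x 0 = 0 :> R[i].
Proof. by rewrite -[0](subrr x) innerDr innerNr subrr. Qed.

Lemma inner0l x : inner 0 x = 0 :> R[i].
Proof. by rewrite innerC inner0r conjc0. Qed.

Definition innerE :=
  (innerDl, @innerDr _ H, innerZl, @innerZr _ H, innerNl, innerNr).

(** The underlying real inner product: orthogonality to real subspaces, such as orbits of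
    self-adjoint elements, is needed later. *)
Definition rinner x y : R := complex.Re (inner x y).

Lemma rinnerC x y : rinner x y = rinner y x.
Proof. by rewrite /rinner innerC; case: (inner y x). Qed.

Lemma rinnerDr x y z : rinner x (y + z) = rinner x y + rinner x z.
Proof. by rewrite /rinner innerDr; case: (inner x y); case: (inner x z). Qed.

Lemma rinnerDl x y z : rinner (x + y) z = rinner x z + rinner y z.
Proof. by rewrite rinnerC rinnerDr -!(rinnerC z). Qed.

Lemma rinnerZr (r : R) x y : rinner x (r%:C *: y) = r * rinner x y.
Proof.
by rewrite /rinner innerZr; case: (inner x y) => a b /=; rewrite mul0r subr0.
Qed.

Lemma rinnerZl (r : R) x y : rinner (r%:C *: x) y = r * rinner x y.
Proof. by rewrite rinnerC rinnerZr rinnerC. Qed.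

Lemma rinnerNr x y : rinner x (- y) = - rinner x y.
Proof. by rewrite /rinner innerNr; case: (inner x y). Qed.

Lemma rinnerNl x y : rinner (- x) y = - rinner x y.
Proof. by rewrite rinnerC rinnerNr rinnerC. Qed.

Definition rinnerE :=
  (rinnerDl, rinnerDr, rinnerZl, rinnerZr, rinnerNl, rinnerNr).

Lemma inner_rn x : inner x x = (rn x ^+ 2)%:C.
Proof. by rewrite inner_norm rnE rmorphXn. Qed.

Lemma rinner_rn x : rinner x x = rn x ^+ 2.
Proof. by rewrite /rinner inner_rn. Qed.

Lemma rn_sqrD x y : rn (x + y) ^+ 2 = rn x ^+ 2 + 2 * rinner x y + rn y ^+ 2.
Proof. by rewrite -!rinner_rn !rinnerE (rinnerC y x); ring. Qed.

Lemma rn_sqrB x y : rn (x - y) ^+ 2 = rn x ^+ 2 - 2 * rinner x y + rn y ^+ 2.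
Proof. by rewrite rn_sqrD rinnerNr rnN; ring. Qed.

Lemma rinner_le x y : rinner x y <= rn x * rn y.
Proof.
have [->|/eqP/rn_gt0 x0] := eqVneq x 0.
  by rewrite /rinner inner0l rn0 mul0r.
have [->|/eqP/rn_gt0 y0] := eqVneq y 0.
  by rewrite /rinner inner0r rn0 mulr0.
have := sqr_ge0 (rn ((rn y)%:C *: x - (rn x)%:C *: y)).
rewrite rn_sqrB !rnZ !normc_real !ger0_norm ?rn_ge0 // !rinnerE.
have xy : 0 < rn x * rn y by rewrite mulr_gt0.
have -> : (rn y * rn x) ^+ 2 - 2 * (rn y * (rn x * rinner x y)) +
  (rn x * rn y) ^+ 2 = 2 * (rn x * rn y) * (rn x * rn y - rinner x y) by ring.
by rewrite pmulr_rge0 ?subr_ge0 // mulr_gt0.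
Qed.

(** Multiplying [x] by [inner x y] makes the inner product with [y] real and nonnegative, which
    reduces the bound to [rinner_le]. *)
Lemma normc_inner_le x y : normc (inner x y) <= rn x * rn y.
Proof.
set c := inner x y.
have [->|c0] := eqVneq c 0.
  by rewrite normc0 mulr_ge0 ?rn_ge0.
have nc0 : 0 < normc c.
  by rewrite lt_def; apply/andP; split;
    [apply: contra_neq c0; exact: eq0_normc | case: (c) => a b /=; rewrite sqrtr_ge0].
have := rinner_le (c *: x) y.
rewrite /rinner innerZl -/c rnZ -mulrA.
have -> : complex.Re (conjc c * c) = normc c * normc c.
  case: (c) => a b /=; rewrite -[RHS]expr2 sqr_sqrtr ?addr_ge0 ?sqr_ge0 //; ring.
by rewrite ler_pM2l.
Qed.

End hilbert.

Lemma closed_rn (R : realType) (E : normedModType R[i]) (V : set E) :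
  (forall x, (forall e : R, 0 < e -> exists2 y, V y & rn (x - y) < e) -> V x) ->
  closed V.
Proof.
move=> h x clx; apply: h => e e0.
have [|y [Vy]] := clx (ball x e%:C); first by apply: nbhsx_ballx; rewrite ltcR.
by rewrite -ball_normE /ball_ /= rnE ltcR => xy; exists y.
Qed.

(** * Operators commuting with an irreducible representation *)

Section representation_theory.
Variables (R : realType) (A : unitalCStarType R) (H : hilbertType R).
Variable pi : representation A H.
Hypothesis pi_nonzero : nonzero_rep pi.
Hypothesis pi_irreducible : irreducible_rep pi.
Local Notation "a ** b" := (cstar_mul a b) (at level 40, left associativity).
Local Notation e1 := (cstar_one : A).

Lemma repDv a (x y : H) : pi a (x + y) = pi a x + pi a y.
Proof. exact: raddfD. Qed.

Lemma repZv a (c : R[i]) (x : H) : pi a (c *: x) = c *: pi a x.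
Proof. exact: linearZ. Qed.

Lemma repNv a (x : H) : pi a (- x) = - pi a x.
Proof. exact: raddfN. Qed.

Lemma repN a (x : H) : pi (- a) x = - pi a x.
Proof. by rewrite -scaleN1r repZ scaleN1r. Qed.

Definition repE := (repDv, repZv, repNv, @repD _ _ _ pi, @repZ _ _ _ pi, repN,
  @repM _ _ _ pi).

Lemma repB a b (x : H) : pi (a - b) x = pi a x - pi b x.
Proof. by rewrite !repE. Qed.

(** The kernel of a bounded operator commuting with [pi] is a closed invariant subspace. *)
Lemma invariant_ker (P : H -> H) (C : R) : additive_map P ->
  (forall c v, P (c *: v) = c *: P v) -> (forall v, rn (P v) <= C * rn v) ->
  (forall a v, P (pi a v) = pi a (P v)) ->
  (forall v, P v = 0) \/ (forall v, P v = 0 -> v = 0).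
Proof.
move=> PD PZ PC Ppi; pose V := [set v | P v = 0].
have [||||VE] := pi_irreducible (V := V).
- split; first by rewrite in_setE /V /= additive_map0.
  move=> c u v; rewrite !in_setE /V /= => Pu Pv.
  by rewrite PD PZ Pu Pv scaler0 addr0.
- apply: closed_rn => v hv; apply: rn_le_eps => e e0; rewrite subr0.
  have C0 : 0 < `|C| + 1 by rewrite ltr_wpDl.
  have [w Pw] := hv _ (divr_gt0 e0 C0); rewrite ltr_pdivlMr // => h.
  rewrite -[P v]subr0 -Pw -additive_mapB //.
  apply: le_lt_trans (PC _) (le_lt_trans _ h).
  rewrite mulrC ler_wpM2l ?rn_ge0 //.
  by rewrite (le_trans (ler_norm C)) // lerDl.
- by move=> a x; rewrite /V /= => Px; rewrite Ppi Px raddf0.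
- by move=> VE; right => v Pv; have : V v by []; rewrite VE.
- by left => v; have : V v by rewrite VE.
Qed.

Lemma rep_bounded_rn a : exists C : R, forall v : H, rn (pi a v) <= C * rn v.
Proof.
have [M hM] := rep_bounded pi a; exists (complex.Re M) => v.
have := hM v; rewrite !rnE lecE => /andP[_]; case: (M) => x y /=.
by rewrite mulr0 subr0.
Qed.

(** The operator 1 - [pi e1] commutes with [pi], so it is zero or injective. It kills every
    [pi a x], so injectivity would make the representation zero. *)
Lemma rep_one (v : H) : pi e1 v = v.
Proof.
have [C hC] := rep_bounded_rn e1.
have [|c w|w|a w|h|h] := @invariant_ker (fun v => v - pi e1 v) (1 + C).
- by move=> x y; rewrite repE; lmod.
- by rewrite repE; lmod.
- by have := rnB w (pi e1 w); have := hC w; lra.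
- by rewrite !repE -!repM cstar_mul1l cstar_mul1r.
- by have /eqP := h v; rewrite subr_eq0 => /eqP <-.
have [a [x ax]] := pi_nonzero; case: ax; apply: h.
by rewrite -repM cstar_mul1l subrr.
Qed.

Lemma rep_adjoint a (x y : H) : inner (pi a x) y = inner x (pi (star a) y) :> R[i].
Proof. by rewrite -rep_star starK. Qed.

(** After normalizing to |b| = 1, the root r of 1 - [star b ** b] gives |b v|^2 + |r v|^2 =
    |v|^2. *)
Lemma rep_contraction a (v : H) : rn (pi a v) <= rn a * rn v.
Proof.
have [->|/eqP/rn_gt0 a0] := eqVneq a 0.
  have -> : pi 0 v = 0 by rewrite -(scale0r (0 : A)) repZ scale0r.
  by rewrite !rn0 mul0r.
pose b := ((rn a)^-1)%:C *: a.
have b1 : rn b <= 1.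
  by rewrite rnZ normc_real ger0_norm ?invr_ge0 ?rn_ge0 // mulVf ?gt_eqF.
have bb1 : rn (star b ** b) <= 1 by rewrite rn_cstar expr_le1 ?rn_ge0.
have bbs : star (star b ** b) = star b ** b by rewrite starM starK.
have E : rn (pi b v) ^+ 2 + rn (pi (sqrt1m (star b ** b)) v) ^+ 2 = rn v ^+ 2.
  have rr := sqrt1mE bb1; have rs := sqrt1m_star bb1 bbs.
  move: (sqrt1m _) rr rs => r rr rs.
  rewrite -!rinner_rn /rinner !rep_adjoint rs -!repM rr repB rep_one.
  by rewrite innerDr innerNr; case: (inner v v); case: (inner v _) => *; rewrite /=; ring.
have bv : rn (pi b v) <= rn v.
  rewrite -ler_sqr ?nnegrE ?rn_ge0 // -E lerDl sqr_ge0 //.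
have aE : a = (rn a)%:C *: b.
  by rewrite /b scalerA -rmorphM /= mulfV ?gt_eqF // rmorph1 scale1r.
rewrite {1}aE repZ rnZ normc_real ger0_norm ?rn_ge0 //.
by rewrite ler_wpM2l ?rn_ge0.
Qed.

(** An approximate eigenvector of [c] is one of [clamp c], with the eigenvalue transformed by 2t/(1
    + t^2). With d = c v - l v and g the resolvent, g v = (v + i g d)/(1 - i l), and similarly for
    the adjoint of g. *)
Lemma rep_clamp c (l : R) (v : H) : star c = c ->
  rn (pi (clamp c) v - (2 * l / (1 + l ^+ 2))%:C *: v) <=
  4 * rn (pi c v - l%:C *: v).
Proof.
move=> cs; pose d := pi c v - l%:C *: v; rewrite -/d.
have [_ h2] := resolventP cs; have [_ h4] := resolvent_starP cs.
set g := resolvent c in h2 h4; set m : R := (1 + l ^+ 2)^-1.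
have cv : pi c v = l%:C *: v + d by rewrite /d; lmod.
clearbody d.
have D : 1 + l ^+ 2 != 0 by rewrite gt_eqF // ltr_wpDr ?sqr_ge0.
have D' : 1 + l%:C ^+ 2 != 0 :> R[i].
  by rewrite -rmorphXn -(rmorph1 (real_complex R)) -rmorphD /= (fmorph_eq0 (real_complex R)).
have mE : m%:C = (1 + l%:C ^+ 2)^-1 :> R[i].
  by rewrite /m rmorphV ?unitfE //= rmorphD rmorphXn rmorph1.
have E1 : pi g v = m%:C *: ((1 + iC * l%:C) *: (v + iC *: pi g d)).
  have : pi (g ** (e1 - iC *: c)) v = v by rewrite h2 rep_one.
  rewrite !repE !rep_one cv !repE mE => e; rewrite -{2}e.
  by lmod_eq R[i]; field: (sqr_i R).
have E2 : pi (star g) v = m%:C *: ((1 - iC * l%:C) *: (v - iC *: pi (star g) d)).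
  have : pi (star g ** (e1 + iC *: c)) v = v by rewrite h4 rep_one.
  rewrite !repE !rep_one cv !repE mE => e; rewrite -{2}e.
  by lmod_eq R[i]; field: (sqr_i R).
have -> : pi (clamp c) v - (2 * l / (1 + l ^+ 2))%:C *: v =
    m%:C *: ((pi g d + pi (star g) d) +
             l%:C *: (iC *: (pi g d - pi (star g) d))).
  rewrite /clamp -/g !repE E1 E2 -/m !rmorphM rmorph_nat.
  by lmod_eq R[i]; ring: (sqr_i R).
have gd w : rn w <= 1 -> rn (pi w d) <= rn d.
  move=> w1; apply: le_trans (rep_contraction _ _) _.
  by rewrite ler_piMl ?rn_ge0.
have g1 := gd _ (rn_resolvent cs).
have g2 : rn (pi (star g) d) <= rn d by apply: gd; rewrite rn_star rn_resolvent.
have m0 : 0 < m by rewrite invr_gt0 ltr_wpDr ?sqr_ge0.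
(* This factor 2 and the bounds 2 |d| on the sum and the difference of the two resolvent terms give
   the constant 4. *)
have ml : m * (1 + `|l|) <= 2.
  rewrite /m mulrC ler_pdivrMr ?ltr_wpDr ?sqr_ge0 //.
  have -> : l ^+ 2 = `|l| ^+ 2 by rewrite -normrX ger0_norm ?sqr_ge0.
  have := sqr_ge0 (`|l| - 1); have := normr_ge0 l; nra.
rewrite rnZ normc_real gtr0_norm //.
set p := pi g d + _; set q := pi g d - _.
have hp : rn p <= 2 * rn d by have := rnD (pi g d) (pi (star g) d); lra.
have hq : rn q <= 2 * rn d by have := rnB (pi g d) (pi (star g) d); lra.
have := rnD p (l%:C *: (iC *: q)).
rewrite !rnZ normc_real normc_i mul1r => h.
have h' := ler_wpM2l (normr_ge0 l) hq.
have h5 : rn (p + l%:C *: (iC *: q)) <= (1 + `|l|) * (2 * rn d) by lra.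
have := ler_wpM2l (ltW m0) h5; rewrite mulrA.
have := ler_wpM2r (mulr_ge0 (ler0n R 2) (rn_ge0 d)) ml; lra.
Qed.

(* Schur's lemma for self-adjoint operators: if S were neither nonnegative nor
   nonpositive, the kernel of |S| + S would be a proper invariant subspace. *)
Lemma commutant_signed (S : H -> H) (C : R) : additive_map S ->
  (forall c v, S (c *: v) = c *: S v) -> (forall v, rn (S v) <= C * rn v) ->
  (forall a v, S (pi a v) = pi a (S v)) ->
  (forall v w, rinner (S v) w = rinner v (S w)) ->
  (forall v, 0 <= rinner v (S v)) \/ (forall v, rinner v (S v) <= 0).
Proof.
move=> SD SZ SC Spi Ssym.
have K0 : 0 < `|C| + 1 by rewrite ltr_wpDl.
set K := `|C| + 1 in K0; pose T v := (K^-1)%:C *: S v.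
have SK v : rn (S v) <= K * rn v.
  apply: le_trans (SC v) _; rewrite ler_wpM2r ?rn_ge0 //.
  by rewrite (le_trans (ler_norm C)) // lerDl.
have TD : additive_map T by move=> v w; rewrite /T SD scalerDr.
have TZ c v : T (c *: v) = c *: T v by rewrite /T SZ; lmod.
have T1 v : rn (T v) <= rn v.
  rewrite rnZ normc_real gtr0_norm ?invr_gt0 // mulrC ler_pdivrMr //.
  by rewrite mulrC SK.
have Tpi a v : T (pi a v) = pi a (T v) by rewrite /T Spi repE.
have Tsym v w : rinner (T v) w = rinner v (T w) by rewrite /T !rinnerE Ssym.
have ST v : rinner v (S v) = K * rinner v (T v).
  by rewrite /T rinnerZr mulrA mulfV ?mul1r // gt_eqF.
clearbody T; pose X v := v - T (T v).
have XD : additive_map X by move=> v w; rewrite /X !TD; lmod.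
have X1 v : rn (X v) <= rn v.
  rewrite -ler_sqr ?nnegrE ?rn_ge0 // rn_sqrB -Tsym rinner_rn.
  have : rn (T (T v)) ^+ 2 <= rn (T v) ^+ 2 by rewrite ler_sqr ?nnegrE ?rn_ge0.
  have := sqr_ge0 (rn (T v)); lra.
have [Y hY] := sqrt_iter_lim XD X1.
have YD := sqrt_op_additive XD hY; have Y1 := sqrt_op_le X1 hY.
have YE := sqrt_op_eq XD X1 hY.
have TY v : T (Y v) = Y (T v).
  apply: (sqrt_op_comm hY (C := 1) TD) => w; first by rewrite mul1r.
  by rewrite /X (additive_mapB TD).
have YZ c v : Y (c *: v) = c *: Y v.
  apply/esym; apply: (sqrt_op_comm hY (Z := fun w => c *: w) (C := normc c)).
  - by move=> u w; rewrite scalerDr.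
  - by move=> w; rewrite rnZ.
  - by move=> w /=; rewrite /X !TZ; lmod.
have Ypi a v : Y (pi a v) = pi a (Y v).
  apply/esym; apply: (sqrt_op_comm hY (Z := pi a) (C := rn a)).
  - by move=> u w; rewrite repE.
  - by move=> w; exact: rep_contraction.
  - by move=> w; rewrite /X !Tpi !repE.
(* Since X = 1 - T^2, this is the square root |T| of T^2. *)
pose B v := v - Y v.
have BB v : B (B v) = T (T v).
  rewrite /B (additive_mapB YD).
  have : Y (Y v) = 2 *: Y v - X v by rewrite [in RHS]YE; lmod.
  by move=> ->; rewrite /X; lmod.
have B0 v : 0 <= rinner v (B v).
  rewrite /B rinnerDr rinnerNr rinner_rn.
  have := rinner_le v (Y v); have := Y1 v; have := rn_ge0 v; nra.
have TB v : T (B v) = B (T v) by rewrite /B (additive_mapB TD) TY.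
(* If |T| + T vanishes, then T = - |T| is nonpositive. If it is injective, then (|T| + T)(|T| - T) =
   0 forces T = |T|. *)
have [||||h|h] := @invariant_ker (fun v => B v + T v) (2 + 1).
- by move=> v w; rewrite /B YD TD; lmod.
- by move=> c v; rewrite /B YZ TZ; lmod.
- move=> v; have := rnD (B v) (T v); have := rnB v (Y v).
  by have := Y1 v; have := T1 v; rewrite /B; lra.
- by move=> a v; rewrite /B Ypi Tpi !repE.
- right => v; rewrite ST; have /eqP := h v; rewrite addr_eq0 => /eqP e.
  have := B0 v; rewrite e rinnerNr; nra.
- left => v; rewrite ST.
  have e : B v - T v = 0.
    have BD : additive_map B by move=> u w; rewrite /B YD; lmod.
    apply: h; rewrite (additive_mapB BD) (additive_mapB TD) BB TB; lmod.
  by move/eqP: e; rewrite subr_eq0 => /eqP <-; exact: mulr_ge0 (ltW K0) (B0 v).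
Qed.

(** Let l be the Rayleigh quotient at a nonzero [v0]. Each S - m is signed; for m = l + d and m = l
    - d the sign is decided at [v0], and letting d tend to 0 gives S - l a zero quadratic form. *)
Lemma commutant_selfadjoint (S : H -> H) (C : R) : additive_map S ->
  (forall c v, S (c *: v) = c *: S v) -> (forall v, rn (S v) <= C * rn v) ->
  (forall a v, S (pi a v) = pi a (S v)) ->
  (forall v w, rinner (S v) w = rinner v (S w)) ->
  exists l : R, forall v, S v = l%:C *: v.
Proof.
move=> SD SZ SC Spi Ssym.
have [v0 v00] : exists v0 : H, 0 < rn v0.
  have [a [x ax]] := pi_nonzero; exists x; apply: rn_gt0 => x0.
  by apply: ax; rewrite x0 raddf0.
pose l := rinner v0 (S v0) / rn v0 ^+ 2.
have l0 : rinner v0 (S v0) = l * rn v0 ^+ 2.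
  by rewrite /l mulfVK // gt_eqF // exprn_gt0.
have v02 : 0 < rn v0 ^+ 2 by rewrite exprn_gt0.
have sgn (m : R) : (forall v, m * rn v ^+ 2 <= rinner v (S v)) \/
    (forall v, rinner v (S v) <= m * rn v ^+ 2).
  have E v : rinner v (S v - m%:C *: v) = rinner v (S v) - m * rn v ^+ 2.
    by rewrite !rinnerE rinner_rn.
  have [|c v|v|a v|v w|h|h] :=
    @commutant_signed (fun v => S v - m%:C *: v) (C + `|m|).
  - by move=> v w; rewrite SD; lmod.
  - by rewrite SZ; lmod.
  - have := rnB (S v) (m%:C *: v); rewrite rnZ normc_real.
    by have := SC v; lra.
  - by rewrite Spi !repE.
  - by rewrite !rinnerE Ssym.
  - by left => v; have := h v; rewrite E; lra.
  - by right => v; have := h v; rewrite E; lra.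
have up v : rinner v (S v) <= l * rn v ^+ 2.
  apply/ler_addgt0Pr => e e0.
  have w0 : 0 < rn v ^+ 2 + 1 by rewrite ltr_wpDl ?sqr_ge0.
  pose d := e / (rn v ^+ 2 + 1); have d0 : 0 < d by rewrite divr_gt0.
  have de : d * rn v ^+ 2 <= e.
    by rewrite /d mulrAC ler_pdivrMr // ler_pM2l // lerDl.
  case: (sgn (l + d)) => [/(_ v0)|/(_ v)]; first by rewrite l0; nra.
  by lra.
have lo v : l * rn v ^+ 2 <= rinner v (S v).
  apply/ler_addgt0Pr => e e0.
  have w0 : 0 < rn v ^+ 2 + 1 by rewrite ltr_wpDl ?sqr_ge0.
  pose d := e / (rn v ^+ 2 + 1); have d0 : 0 < d by rewrite divr_gt0.
  have de : d * rn v ^+ 2 <= e.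
    by rewrite /d mulrAC ler_pdivrMr // ler_pM2l // lerDl.
  case: (sgn (l - d)) => [/(_ v)|/(_ v0)]; last by rewrite l0; nra.
  by lra.
pose D v := S v - l%:C *: v.
have D0 v : rinner v (D v) = 0.
  rewrite /D !rinnerE rinner_rn; apply/eqP; rewrite subr_eq0.
  by rewrite eq_le up lo.
have DD : additive_map D by move=> v w; rewrite /D SD; lmod.
have Dsym v w : rinner (D v) w = rinner v (D w).
  by rewrite /D !rinnerE Ssym.
have DE v : S v = l%:C *: v + D v by rewrite /D; lmod.
clearbody D; exists l => v; rewrite DE.
suff -> : D v = 0 by rewrite addr0.
apply/rn_eq0/eqP; rewrite -sqrf_eq0 -rinner_rn.
(* Polarization: the form of D at v + D v equals 2 |D v|^2. *)
have := D0 (v + D v); rewrite DD !rinnerE !D0 -(Dsym v (D v)).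
move=> /eqP; rewrite add0r addr0 -mulr2n mulrn_eq0 /= => h; exact: h.
Qed.

(** The real and imaginary parts (S + S')/2 and (S - S')/(2i) are symmetric and commute with [pi],
    so both are scalars. *)
Lemma commutant_scalar (S S' : H -> H) (C : R) :
  additive_map S -> additive_map S' ->
  (forall c v, S (c *: v) = c *: S v) -> (forall c v, S' (c *: v) = c *: S' v) ->
  (forall v, rn (S v) <= C * rn v) -> (forall v, rn (S' v) <= C * rn v) ->
  (forall a v, S (pi a v) = pi a (S v)) ->
  (forall a v, S' (pi a v) = pi a (S' v)) ->
  (forall v w, rinner (S v) w = rinner v (S' w)) ->
  exists l : R[i], forall v, S v = l *: v.
Proof.
move=> SD SD' SZ SZ' SC SC' Sp Sp' adj.
have adj' v w : rinner (S' v) w = rinner v (S w).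
  by rewrite rinnerC -adj rinnerC.
have adji v w : rinner (iC *: v) w = - rinner v (iC *: w).
  rewrite /rinner innerZl innerZr; case: (inner v w) => a b /=; ring.
have [|c v|v|a v|v w|l1 h1] :=
  @commutant_selfadjoint (fun v => S v + S' v) (C + C).
- by move=> v w; rewrite SD SD'; lmod.
- by rewrite SZ SZ'; lmod.
- by have := rnD (S v) (S' v); have := SC v; have := SC' v; lra.
- by rewrite Sp Sp' !repE.
- by rewrite !rinnerE adj adj' addrC.
have [|c v|v|a v|v w|l2 h2] :=
  @commutant_selfadjoint (fun v => iC *: (S v - S' v)) (C + C).
- by move=> v w; rewrite SD SD'; lmod.
- by rewrite SZ SZ'; lmod.
- rewrite rnZ normc_i mul1r.
  by have := rnB (S v) (S' v); have := SC v; have := SC' v; lra.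
- by rewrite Sp Sp' !repE.
- by rewrite adji scalerBr -SZ -SZ' !rinnerE adj adj'; ring.
exists (2^-1 * (l1%:C - iC * l2%:C)) => v.
have -> : S v = 2^-1 *: ((S v + S' v) - iC *: (iC *: (S v - S' v))).
  by lmod_eq R[i]; field: (sqr_i R).
by rewrite h1 h2; lmod.
Qed.

End representation_theory.

(** * Projections *)

Section projection.
Variables (R : realType) (V : lmodType R[i]) (dot : V -> V -> R).
Hypothesis dotC : forall u v, dot u v = dot v u.
Hypothesis dotD : forall u v w, dot (u + v) w = dot u w + dot v w.
Hypothesis dotZ : forall (r : R) u v, dot (r%:C *: u) v = r * dot u v.
Hypothesis dot_ge0 : forall u, 0 <= dot u u.
Hypothesis dot_complete : forall u : nat -> V,
  (forall e, 0 < e -> exists N, forall m n, (N <= m)%N -> (N <= n)%N ->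
     dot (u m - u n) (u m - u n) < e) ->
  exists l, forall e, 0 < e -> exists N, forall n, (N <= n)%N ->
     dot (u n - l) (u n - l) < e.

Lemma dotN u v : dot (- u) v = - dot u v.
Proof.
have -> : - u = (-1)%:C *: u by rewrite rmorphN rmorph1 scaleN1r.
by rewrite dotZ mulN1r.
Qed.

Lemma dotB u v w : dot (u - v) w = dot u w - dot v w.
Proof. by rewrite dotD dotN. Qed.

Lemma dotBr u v w : dot w (u - v) = dot w u - dot w v.
Proof. by rewrite dotC dotB !(dotC w). Qed.

Lemma dotZr (r : R) u v : dot v (r%:C *: u) = r * dot v u.
Proof. by rewrite dotC dotZ dotC. Qed.

Lemma dotDr u v w : dot w (u + v) = dot w u + dot w v.
Proof. by rewrite dotC dotD !(dotC w). Qed.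

Lemma dot_parallelogram a b : dot (b - a) (b - a) =
  2 * dot a a + 2 * dot b b - 4 * dot (2^-1%:C *: (a + b)) (2^-1%:C *: (a + b)).
Proof.
by rewrite dotZ dotZr dotB !dotBr dotD !dotDr (dotC b a); field.
Qed.

Lemma dot_sub_scale a (t : R) l : dot (a - t%:C *: l) (a - t%:C *: l) =
  dot a a - 2 * t * dot a l + t ^+ 2 * dot l l.
Proof. by rewrite dotB !dotBr !dotZ !dotZr (dotC l a); ring. Qed.

(** A weak Cauchy-Schwarz inequality; the added 1 avoids dividing by [dot l l], which may vanish. *)
Lemma dot_sqr_le x l : dot x l ^+ 2 <= (dot l l + 1) * dot x x.
Proof.
have c0 : 0 < dot l l + 1 by rewrite ltr_wpDl.
pose t := dot x l / (dot l l + 1).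
have tc : t * (dot l l + 1) = dot x l by rewrite /t mulfVK // gt_eqF.
have := dot_ge0 (x - t%:C *: l); rewrite dot_sub_scale.
have := sqr_ge0 t; rewrite -tc; nra.
Qed.

Definition in_closure (L : V -> Prop) (p : V) : Prop :=
  forall e, 0 < e -> exists2 l, L l & dot (p - l) (p - l) < e.

Lemma orthogonal_closure (L : V -> Prop) q p :
  (forall l, L l -> dot q l = 0) -> in_closure L p -> dot q p = 0.
Proof.
move=> qL hp; apply/eqP; rewrite -sqrf_eq0 eq_le sqr_ge0 andbT.
apply/ler_addgt0Pr => e e0; rewrite add0r.
have c0 : 0 < dot q q + 1 by rewrite ltr_wpDl.
have [l Ll hl] := hp _ (divr_gt0 e0 c0).
have -> : dot q p = dot (p - l) q by rewrite dotB (dotC p) (dotC l) (qL l Ll) subr0.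
apply: le_trans (dot_sqr_le _ _) _.
by rewrite mulrC -ler_pdivlMr // ltW.
Qed.

(** A minimizing sequence for the distance to [L] is Cauchy by the parallelogram identity, and its
    limit has the orthogonality property. Closure under real scalars only is assumed so that the
    lemma also covers orbits of self-adjoint elements. *)
Lemma projection_exists (L : V -> Prop) (v : V) : L 0 ->
  (forall u w, L u -> L w -> L (u + w)) ->
  (forall (r : R) u, L u -> L (r%:C *: u)) ->
  exists p, in_closure L p /\ forall l, L l -> dot (v - p) l = 0.
Proof.
move=> L0 LD LZ; pose q l := dot (v - l) (v - l).
pose Q : set R := [set q l | l in [set l | L l]].
have hQ : has_inf Q.
  by split; [exists (q 0), 0|exists 0 => _ [l _ <-]; exact: dot_ge0].
pose D := inf Q.
have Dle l : L l -> D <= q l.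
  by move=> Ll; apply: ge_inf; [case: hQ|exists l].
have ex (k : nat) : exists l, L l /\ q l < D + k.+1%:R^-1.
  have [|_ [l Ll <-] hl] := @inf_adherent _ Q k.+1%:R^-1 _ hQ.
    by rewrite invr_gt0 ltr0n.
  by exists l.
pose s k := sval (cid (ex k)).
have sL k : L (s k) by rewrite /s; case: cid => l [].
have sq k : q (s k) < D + k.+1%:R^-1 by rewrite /s; case: cid => l [].
clearbody s.
have inv_le m n : (m <= n)%N -> (n.+1%:R : R)^-1 <= m.+1%:R^-1.
  by move=> mn; rewrite lef_pV2 ?posrE ?ltr0n // ler_nat ltnS.
have arch (e : R) : 0 < e -> exists N : nat, (N.+1%:R : R)^-1 < e.
  move=> e0; exists (Num.truncn e^-1); rewrite invf_plt ?posrE ?ltr0n //.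
  by rewrite truncnS_gt.
have [|p hp] := dot_complete (u := s) _.
  (* The midpoint of two terms lies in [L], so their squared distance is below 2/(m + 1) + 2/(n +
     1), at most 4/(N + 1). *)
  move=> e e0; have [N hN] := arch (e / 4) (divr_gt0 e0 (ltr0Sn _ 3)).
  exists N => m n Nm Nn.
  have hh : (2^-1 : R[i]) = (2^-1 : R)%:C by rewrite rmorphV ?unitfE // rmorph_nat.
  have mid : L (2^-1 *: (s m + s n)) by rewrite hh; apply: LZ; apply: LD.
  have := Dle _ mid; have := sq m; have := sq n.
  have := inv_le _ _ Nm; have := inv_le _ _ Nn.
  have -> : q (2^-1 *: (s m + s n)) =
      (2 * q (s m) + 2 * q (s n) - dot (s m - s n) (s m - s n)) / 4.
    rewrite /q; set a := v - s m; set b := v - s n.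
    have -> : v - 2^-1 *: (s m + s n) = (2^-1)%:C *: (a + b).
      by rewrite -hh /a /b; lmod.
    have -> : s m - s n = b - a by rewrite /a /b; lmod.
    by rewrite (dot_parallelogram a b); field.
  move: hN; move: (N.+1%:R^-1 : R) (n.+1%:R^-1 : R) (m.+1%:R^-1 : R).
  move=> *; lra.
exists p; split.
  move=> e e0; have [N hN] := hp _ e0; exists (s N) => //.
  by rewrite -opprB dotN dotC dotN opprK hN.
move=> l Ll; apply/eqP; rewrite -sqrf_eq0 eq_le sqr_ge0 andbT.
apply/ler_addgt0Pr => e e0; rewrite add0r.
have c0 : 0 < dot l l + 1 by rewrite ltr_wpDl.
have [N hN] := arch _ (divr_gt0 (divr_gt0 e0 (ltr0Sn _ 3)) c0).
have [M hM] := hp _ (divr_gt0 (divr_gt0 e0 (ltr0Sn _ 3)) c0).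
pose k := maxn N M.
have hk : (k.+1%:R : R)^-1 < e / 4 / (dot l l + 1).
  by apply: le_lt_trans hN; apply: inv_le; exact: leq_maxl.
have {}hM := hM k (leq_maxr _ _).
(* Moving from [s k] along [l] stays in [L], so it can lower [q] by less than 1/(k + 1). *)
have b2 : dot (v - s k) l ^+ 2 <= (dot l l + 1) * k.+1%:R^-1.
  pose t := dot (v - s k) l / (dot l l + 1).
  have tc : t * (dot l l + 1) = dot (v - s k) l by rewrite /t mulfVK // gt_eqF.
  have := Dle (s k + t%:C *: l) (LD _ _ (sL k) (LZ _ _ Ll)).
  have -> : q (s k + t%:C *: l) = q (s k) - 2 * t * dot (v - s k) l + t ^+ 2 * dot l l.
    by rewrite /q opprD addrA dot_sub_scale.
  have := sq k; rewrite -tc; have := sqr_ge0 t; move: (k.+1%:R^-1 : R).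
  move=> *; nra.
have d2 := dot_sqr_le (s k - p) l.
have -> : dot (v - p) l = dot (v - s k) l + dot (s k - p) l.
  by rewrite -dotD addrA subrK.
have h1 : (dot l l + 1) * k.+1%:R^-1 <= e / 4.
  by rewrite mulrC -ler_pdivlMr // ltW.
have h2 : (dot l l + 1) * dot (s k - p) (s k - p) <= e / 4.
  by rewrite mulrC -ler_pdivlMr // ltW.
have {h1}b3 := le_trans b2 h1; have {h2}d3 := le_trans d2 h2.
have := sqr_ge0 (dot (v - s k) l - dot (s k - p) l).
by clear b2 d2 hk hM hN; move: (dot (v - s k) l) (dot (s k - p) l) b3 d3 => x y; nra.
Qed.

End projection.

(** * Density of self-adjoint elements *)

Section density.
Variables (R : realType) (A : unitalCStarType R) (H : hilbertType R).
Variable pi : representation A H.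
Hypothesis pi_nonzero : nonzero_rep pi.
Hypothesis pi_irreducible : irreducible_rep pi.
Local Notation "a ** b" := (cstar_mul a b) (at level 40, left associativity).
Local Notation e1 := (cstar_one : A).

(** * Finite direct sums of copies of the Hilbert space, and projections onto orbit closures *)

Definition fdot (I : finType) (u v : {ffun I -> H}) : R :=
  \sum_i rinner (u i) (v i).

Section fdot.
Variable I : finType.
Implicit Types u v w : {ffun I -> H}.

Lemma fdotC u v : fdot u v = fdot v u.
Proof. by apply: eq_bigr => i _; rewrite rinnerC. Qed.

Lemma fdotD u v w : fdot (u + v) w = fdot u w + fdot v w.
Proof. by rewrite -big_split; apply: eq_bigr => i _; rewrite ffunE rinnerDl. Qed.

Lemma fdotZ (r : R) u v : fdot (r%:C *: u) v = r * fdot u v.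
Proof. by rewrite mulr_sumr; apply: eq_bigr => i _; rewrite ffunE rinnerZl. Qed.

Lemma fdot_sqr u : fdot u u = \sum_i rn (u i) ^+ 2.
Proof. by apply: eq_bigr => i _; rewrite rinner_rn. Qed.

Lemma fdot_ge0 u : 0 <= fdot u u.
Proof. by rewrite fdot_sqr sumr_ge0 // => i _; rewrite sqr_ge0. Qed.

Lemma rn_le_fdot u i : rn (u i) ^+ 2 <= fdot u u.
Proof.
rewrite fdot_sqr (bigD1 i) //= lerDl sumr_ge0 // => j _; exact: sqr_ge0.
Qed.

Lemma fdot_eq0 u : fdot u u = 0 -> u = 0.
Proof.
move=> h; apply/ffunP => i; rewrite ffunE; apply/rn_eq0/eqP.
by rewrite -sqrf_eq0 eq_le sqr_ge0 andbT -h rn_le_fdot.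
Qed.

Lemma fdot_complete (u : nat -> {ffun I -> H}) :
  (forall e, 0 < e -> exists N, forall m n, (N <= m)%N -> (N <= n)%N ->
     fdot (u m - u n) (u m - u n) < e) ->
  exists l, forall e, 0 < e -> exists N, forall n, (N <= n)%N ->
     fdot (u n - l) (u n - l) < e.
Proof.
move=> hu; have hl i : exists l : H, rlim (fun n => u n i) l.
  apply: rlim_cauchy => e e0; have [N hN] := hu _ (exprn_gt0 2 e0).
  exists N => n m Nn Nm; rewrite -(ltr_pXn2r (n := 2)) ?nnegrE ?rn_ge0 ?ltW //.
  apply: le_lt_trans (hN n m Nn Nm).
  by have := rn_le_fdot (u n - u m) i; rewrite !ffunE.
exists [ffun i => sval (cid (hl i))] => e e0.
pose d := e / (#|I|.+1%:R); have d0 : 0 < d by rewrite divr_gt0.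
have hN i : exists N, forall n, (N <= n)%N ->
    rn (u n i - sval (cid (hl i))) ^+ 2 < d.
  have s0 : 0 < Num.sqrt d by rewrite sqrtr_gt0.
  case: cid => l /= /(_ _ s0)[N hN]; exists N => n /hN h.
  by rewrite -[ltRHS]sqr_sqrtr ?(ltW d0) // ltr_pXn2r ?nnegrE ?rn_ge0 // ltW.
exists (\max_i sval (cid (hN i))) => n hn; rewrite fdot_sqr.
apply: le_lt_trans (_ : \sum_(i : I) d < e).
  apply: ler_sum => i _; rewrite !ffunE ltW //.
  apply: (svalP (cid (hN i))); apply: leq_trans hn.
  exact: (@leq_bigmax _ (fun i => sval (cid (hN i))) i).
rewrite sumr_const -[ltLHS]mulr_natr /d mulrAC ltr_pdivrMr ?ltr0n //.
by rewrite ltr_pM2l // ltr_nat.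
Qed.

End fdot.

Section block_projection.
Variables (I : finType) (e : {ffun I -> H}).
Implicit Types u v w : {ffun I -> H}.

Definition cyclic_space (u : {ffun I -> H}) : Prop :=
  exists a : A, forall i, u i = pi a (e i).
Local Notation L := cyclic_space.
Local Notation dot := (@fdot I).
Local Notation clL := (in_closure dot L).

Lemma cyclic0 : L 0.
Proof. by exists 0 => i; rewrite ffunE -(scale0r (0 : A)) repZ scale0r. Qed.

Lemma cyclicD u v : L u -> L v -> L (u + v).
Proof. by move=> [a ha] [b hb]; exists (a + b) => i; rewrite ffunE ha hb repD. Qed.

Lemma cyclicZ (c : R[i]) u : L u -> L (c *: u).
Proof. by move=> [a ha]; exists (c *: a) => i; rewrite ffunE ha repZ. Qed.

Lemma cyclicM b u : L u -> L [ffun i => pi b (u i)].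
Proof. by move=> [a ha]; exists (b ** a) => i; rewrite ffunE ha repM. Qed.

Lemma block_projection_exists : exists P : {ffun I -> H} -> {ffun I -> H},
  forall v, clL (P v) /\ forall l, L l -> dot (v - P v) l = 0.
Proof.
have h v := projection_exists (@fdotC I) (@fdotD I) (@fdotZ I) (@fdot_ge0 I)
  (@fdot_complete I) v cyclic0 cyclicD (fun r => @cyclicZ r%:C).
by exists (fun v => sval (cid (h v))) => v; case: cid.
Qed.

Lemma closure_lipschitz (M : {ffun I -> H} -> {ffun I -> H}) (C : R) u :
  {morph M : x y / x - y} -> (forall x, dot (M x) (M x) <= C * dot x x) ->
  (forall l, L l -> L (M l)) -> clL u -> clL (M u).
Proof.
move=> MB MC ML hu d d0.
have C0 : 0 < `|C| + 1 by rewrite ltr_wpDl.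
have [l Ll hl] := hu _ (divr_gt0 d0 C0); exists (M l); first exact: ML.
rewrite -MB; apply: le_lt_trans (MC _) _.
rewrite ltr_pdivlMr // in hl; apply: le_lt_trans hl.
rewrite mulrC ler_wpM2l ?fdot_ge0 //.
by rewrite (le_trans (ler_norm C)) // lerDl.
Qed.

Lemma closureD u v : clL u -> clL v -> clL (u + v).
Proof.
move=> hu hv d d0; have d4 : 0 < d / 4 by lra.
have [l Ll hl] := hu _ d4; have [m Lm hm] := hv _ d4.
exists (l + m); first exact: cyclicD.
have -> : u + v - (l + m) = (u - l) + (v - m) by lmod.
move: (u - l) (v - m) hl hm => x y hx hy.
have := fdot_ge0 (x - y).
rewrite (dotB (@fdotD I) (@fdotZ I)) !(dotBr (@fdotC I) (@fdotD I) (@fdotZ I)).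
rewrite fdotD !(dotDr (@fdotC I) (@fdotD I)) (fdotC y x); lra.
Qed.

Variable P : {ffun I -> H} -> {ffun I -> H}.
Hypothesis hP : forall v, clL (P v) /\ forall l, L l -> dot (v - P v) l = 0.

Lemma closureN u : clL u -> clL (- u).
Proof.
apply: (closure_lipschitz (C := 1)).
- by move=> x y; rewrite opprD.
- move=> x; rewrite mul1r !fdot_sqr; apply: ler_sum => i _.
  by rewrite !ffunE rnN.
- by move=> l /(cyclicZ (-1)); rewrite scaleN1r.
Qed.

Lemma orth_closure q u : (forall l, L l -> dot q l = 0) -> clL u -> dot q u = 0.
Proof.
exact: (orthogonal_closure (@fdotC I) (@fdotD I) (@fdotZ I) (@fdot_ge0 I)).
Qed.

Lemma projection_unique v p : clL p ->
  (forall l, L l -> dot (v - p) l = 0) -> P v = p.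
Proof.
move=> hp orth; have [hPv orthP] := hP v.
have d : forall l, L l -> dot (P v - p) l = 0.
  move=> l Ll; have -> : P v - p = (v - p) + - (v - P v) by lmod.
  by rewrite fdotD (dotN (@fdotZ I)) orth // orthP // oppr0 addr0.
apply/eqP; rewrite -subr_eq0; apply/eqP/fdot_eq0/(orth_closure d).
by apply: closureD => //; exact: closureN.
Qed.

(** As [M] and its adjoint both preserve [L], [M] preserves both the closure of [L] and its
    orthogonal complement. *)
Lemma projection_commutes (M M' : {ffun I -> H} -> {ffun I -> H}) (C : R) :
  {morph M : x y / x - y} -> (forall x, dot (M x) (M x) <= C * dot x x) ->
  (forall l, L l -> L (M l)) -> (forall l, L l -> L (M' l)) ->
  (forall x y, dot (M x) y = dot x (M' y)) ->
  forall v, P (M v) = M (P v).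
Proof.
move=> MB MC ML ML' adj v; have [hPv orthP] := hP v.
apply: projection_unique; first exact: (closure_lipschitz MB MC).
by move=> l Ll; rewrite -MB adj orthP //; exact: ML'.
Qed.

Lemma projectionD : additive_map P.
Proof.
move=> u v; have [hu ou] := hP u; have [hv ov] := hP v.
apply: projection_unique; first exact: closureD.
move=> l Ll; have -> : u + v - (P u + P v) = (u - P u) + (v - P v) by lmod.
by rewrite fdotD ou // ov // addr0.
Qed.

Lemma rinner_conj (c : R[i]) (x y : H) :
  rinner (c *: x) y = rinner x (conjc c *: y).
Proof. by rewrite /rinner innerZl innerZr. Qed.

Lemma projectionZ (c : R[i]) v : P (c *: v) = c *: P v.
Proof.
apply: (projection_commutes (M := fun v => c *: v) (M' := fun v => conjc c *: v)
  (C := normc c ^+ 2)).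
- by move=> x y; rewrite scalerBr.
- move=> x; rewrite !fdot_sqr mulr_sumr; apply: ler_sum => i _.
  by rewrite ffunE rnZ exprMn.
- exact: cyclicZ.
- exact: cyclicZ.
- by move=> x y; apply: eq_bigr => i _; rewrite !ffunE rinner_conj.
Qed.

Lemma projectionM a v : P [ffun i => pi a (v i)] = [ffun i => pi a (P v i)].
Proof.
apply: (projection_commutes (M := fun v => [ffun i => pi a (v i)])
  (M' := fun v => [ffun i => pi (star a) (v i)]) (C := rn a ^+ 2)).
- by move=> x y; apply/ffunP => i; rewrite !ffunE !repE.
- move=> x; rewrite !fdot_sqr mulr_sumr; apply: ler_sum => i _.
  rewrite ffunE -exprMn ler_pXn2r ?nnegrE ?mulr_ge0 ?rn_ge0 //.
  exact: rep_contraction.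
- exact: cyclicM.
- exact: cyclicM.
- by move=> x y; apply: eq_bigr => i _; rewrite !ffunE /rinner rep_adjoint.
Qed.

Lemma projection_sym u v : dot (P u) v = dot u (P v).
Proof.
have [hu ou] := hP u; have [hv ov] := hP v.
have := orth_closure ov hu; have := orth_closure ou hv.
rewrite !(dotB (@fdotD I) (@fdotZ I)) (fdotC v) (fdotC (P v)); lra.
Qed.

Lemma projection_le v : dot (P v) (P v) <= 1 * dot v v.
Proof.
have [hv ov] := hP v; have := orth_closure ov hv.
have := fdot_ge0 (v - P v).
rewrite !(dotB (@fdotD I) (@fdotZ I)) !(dotBr (@fdotC I) (@fdotD I) (@fdotZ I)).
rewrite (fdotC (P v) v); lra.
Qed.

Definition single (j : I) (h : H) : {ffun I -> H} :=
  [ffun i => if i == j then h else 0].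

Lemma singleE v : v = \sum_j single j (v j).
Proof.
apply/ffunP => i; rewrite sum_ffunE (bigD1 i) //= ffunE eqxx big1 ?addr0 //.
by move=> j ji; rewrite ffunE eq_sym (negbTE ji).
Qed.

Lemma dot_single v j h : dot v (single j h) = rinner (v j) h.
Proof.
rewrite /fdot (bigD1 j) //= ffunE eqxx big1 ?addr0 // => i ij.
by rewrite ffunE (negbTE ij) /rinner inner0r.
Qed.

Lemma singleD j : additive_map (single j).
Proof.
by move=> x y; apply/ffunP => i; rewrite !ffunE; case: eqP; rewrite ?addr0.
Qed.

Lemma singleZ j (c : R[i]) h : single j (c *: h) = c *: single j h.
Proof. by apply/ffunP => i; rewrite !ffunE; case: eqP; rewrite ?scaler0. Qed.

Lemma single_rep j a h : single j (pi a h) = [ffun i => pi a (single j h i)].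
Proof. by apply/ffunP => i; rewrite !ffunE; case: eqP; rewrite ?raddf0. Qed.

(* By Schur's lemma the blocks of the projection onto the closure of
   {(pi a (e i))_i} are scalars. *)
Lemma projection_scalar_blocks : exists l : I -> I -> R[i],
  forall i j h, P (single j h) i = l i j *: h.
Proof.
suff H1 i j : exists c : R[i], forall h, P (single j h) i = c *: h.
  exists (fun i j => sval (cid (H1 i j))) => i j h; by case: cid.
have le1 i' j' (w : H) : rn (P (single j' w) i') <= 1 * rn w.
  rewrite -(ler_pXn2r (n := 2)) ?nnegrE ?mulr_ge0 ?rn_ge0 // mul1r.
  apply: le_trans (rn_le_fdot _ _) _; apply: le_trans (projection_le _) _.
  by rewrite mul1r dot_single ffunE eqxx rinner_rn.
apply: (commutant_scalar pi_nonzero pi_irreducible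
  (S' := fun h => P (single i h) j) (C := 1)) => //.
- by move=> x y; rewrite singleD projectionD ffunE.
- by move=> x y; rewrite singleD projectionD ffunE.
- by move=> c x; rewrite singleZ projectionZ ffunE.
- by move=> c x; rewrite singleZ projectionZ ffunE.
- by move=> a x; rewrite single_rep projectionM ffunE.
- by move=> a x; rewrite single_rep projectionM ffunE.
by move=> x y; rewrite -dot_single projection_sym fdotC dot_single rinnerC.
Qed.

End block_projection.

(** The double commutant argument: the projection P fixes [e] and kills [f], and its scalar blocks
    commute with [T] acting diagonally. Hence e = P e, and moving P across the inner product onto
    [f] gives 0. *)
Lemma annihilator_commutant (I : finType) (e f : {ffun I -> H}) :
  (forall a, \sum_i inner (f i) (pi a (e i)) = 0 :> R[i]) ->
  forall T : H -> H, additive_map T -> (forall c v, T (c *: v) = c *: T v) ->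
  \sum_i inner (f i) (T (e i)) = 0 :> R[i].
Proof.
move=> fe T TD TZ.
have [P hP] := block_projection_exists e.
have [l hl] := projection_scalar_blocks hP.
have clL u : cyclic_space e u -> in_closure (@fdot I) (cyclic_space e) u.
  move=> Lu d d0; exists u => //.
  by rewrite subrr /fdot big1 // => i _; rewrite ffunE rinner_rn rn0 expr0n.
have Pe : P e = e.
  apply: (projection_unique hP); last first.
    by move=> u _; rewrite subrr /fdot big1 // => i _; rewrite ffunE /rinner inner0l.
  by apply: clL; exists e1 => i; rewrite rep_one.
have Pf : P f = 0.
  apply: (projection_unique hP); first exact/clL/cyclic0.
  move=> u [a ha]; rewrite subr0 /fdot.
  transitivity (complex.Re (\sum_i inner (f i) (pi a (e i)))); last by rewrite fe.
  rewrite (big_morph (@complex.Re R) (id1 := 0) (op1 := +%R)) //.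
    by apply: eq_bigr => i _; rewrite ha.
  by case=> ? ? [? ?].
have PE v i : P v i = \sum_j l i j *: v j.
  rewrite [in LHS](singleE v) (big_morph P (projectionD hP) (id1 := 0)).
    by rewrite sum_ffunE; apply: eq_bigr => j _; rewrite hl.
  exact: additive_map0 (projectionD hP).
have ladj i j (h : H) : conjc (l i j) *: h = l j i *: h.
  pose x := conjc (l i j) *: h - l j i *: h.
  suff : rinner x x = 0.
    rewrite rinner_rn => /eqP; rewrite sqrf_eq0 => /eqP/rn_eq0/eqP.
    by rewrite subr_eq0 => /eqP.
  rewrite {2}/x rinnerDr rinnerNr -rinner_conj -[l i j *: x]hl -[l j i *: h]hl.
  rewrite (rinnerC x) -!dot_single (projection_sym hP) fdotC.
  by rewrite subrr.
have TS (F : I -> H) : T (\sum_j F j) = \sum_j T (F j).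
  by rewrite (big_morph T TD (id1 := 0)) //; exact: additive_map0.
transitivity (\sum_i \sum_j inner (l j i *: f i) (T (e j))).
  apply: eq_bigr => i _; rewrite -{1}Pe PE TS.
  rewrite (big_morph (inner (f i)) (id1 := 0) (op1 := +%R)); last 2 first.
  - by move=> x y; rewrite innerDr.
  - by rewrite inner0r.
  by apply: eq_bigr => j _; rewrite TZ -ladj innerZr innerZl conjcK.
rewrite exchange_big big1 // => j _.
have := congr1 (fun u : {ffun I -> H} => u j) Pf; rewrite PE ffunE => fj.
transitivity (inner (\sum_i l j i *: f i) (T (e j))); last by rewrite fj inner0l.
rewrite (big_morph (fun x => inner x (T (e j))) (id1 := 0) (op1 := +%R)) //.
  by move=> x y; rewrite innerDl.
by rewrite inner0l.
Qed.

(** Let q be the part of (T e_i) orthogonal to the real space of all (x e_i) with x self-adjoint.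
    Orthogonality to (a + [star a]) e for every a, with i a in place of a as well, becomes the
    complex relation [phi a] = 0. The annihilator lemma extends it to [T], and symmetry of [T] then
    gives q = 0. *)
Lemma selfadjoint_density (I : finType) (e : {ffun I -> H}) (T : H -> H)
    (d : R) :
  additive_map T -> (forall c v, T (c *: v) = c *: T v) ->
  (forall v w, rinner (T v) w = rinner v (T w)) -> 0 < d ->
  exists2 x : A, star x = x & forall i, rn (pi x (e i) - T (e i)) < d.
Proof.
move=> TD TZ Tsym d0.
pose L (u : {ffun I -> H}) := exists2 x : A, star x = x &
  forall i, u i = pi x (e i).
pose v : {ffun I -> H} := [ffun i => T (e i)].
have [|u w|r u|p [clp orth]] := projection_exists (@fdotC I) (@fdotD I)
  (@fdotZ I) (@fdot_ge0 I) (@fdot_complete I) v (L := L).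
- exists 0; first exact: additive_map0 (@star_additive R A).
  by move=> i; rewrite ffunE -(scale0r (0 : A)) repZ scale0r.
- move=> [x xs hx] [y ys hy]; exists (x + y); first by rewrite starD xs ys.
  by move=> i; rewrite ffunE hx hy repD.
- move=> [x xs hx]; exists (r%:C *: x); first by rewrite starZc conjc_real xs.
  by move=> i; rewrite ffunE hx repZ.
suff vp : v = p.
  have [u [x xs hx] hd] := clp _ (exprn_gt0 2 d0); exists x => // i.
  rewrite -(ltr_pXn2r (n := 2)) ?nnegrE ?rn_ge0 ?ltW //.
  apply: le_lt_trans hd; have := rn_le_fdot (p - u) i.
  by rewrite -vp !ffunE hx rn_dist.
have [q qE] : exists q, q = v - p by exists (v - p).
rewrite -qE in orth.
have qp : fdot q p = 0.
  exact: (orthogonal_closure (@fdotC I) (@fdotD I) (@fdotZ I) (@fdot_ge0 I) orth).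
pose phi a := \sum_i (inner (q i) (pi a (e i)) + inner (e i) (pi a (q i))) : R[i].
have phi_re a : complex.Re (phi a) = 0.
  rewrite /phi (big_morph (@complex.Re R) (id1 := 0) (op1 := +%R)) //; last first.
    by case=> ? ? [? ?].
  have : L [ffun i => pi (a + star a) (e i)].
    exists (a + star a); first by rewrite starD starK addrC.
    by move=> i; rewrite ffunE.
  move/orth => qL; rewrite -[RHS]qL; apply: eq_bigr => i _.
  rewrite ffunE !repE rinnerDr {2}/rinner -rep_adjoint -/(rinner _ _).
  rewrite [X in _ = _ + X]rinnerC /rinner.
  by case: (inner _ _) => ? ?; case: (inner _ _).
have phi0 a : phi a = 0.
  have := phi_re (iC *: a).
  have -> : phi (iC *: a) = iC * phi a.
    rewrite /phi mulr_sumr; apply: eq_bigr => i _.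
    by rewrite !repE !innerZr mulrDr.
  have := phi_re a; case: (phi a) => x y /= -> /eqP.
  by rewrite mul0r mul1r sub0r oppr_eq0 => /eqP ->.
(* Doubling the index set writes both sums of [phi] as a single pairing of the form treated by
   [annihilator_commutant]. *)
pose e' : {ffun (I + I)%type -> H} :=
  [ffun k => match k with inl i => e i | inr i => q i end].
pose q' : {ffun (I + I)%type -> H} :=
  [ffun k => match k with inl i => q i | inr i => e i end].
have := annihilator_commutant (e := e') (f := q') _ TD TZ.
rewrite big_sumType /=.
under eq_bigr do rewrite !ffunE.
under [X in _ + X]eq_bigr do rewrite !ffunE.
move=> h.
have {}h : \sum_i (inner (q i) (T (e i)) + inner (e i) (T (q i))) = 0 :> R[i].
  rewrite big_split; apply: h => a.
  rewrite big_sumType -[RHS](phi0 a) /phi big_split /=.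
  by congr (_ + _); apply: eq_bigr => i _; rewrite !ffunE.
have qv : fdot q v = 0.
  have : fdot q v + fdot q v = 0.
    rewrite -big_split -[RHS]/(complex.Re (0 : R[i])) -h.
    rewrite (big_morph (@complex.Re R) (id1 := 0) (op1 := +%R)) //; last first.
      by case=> ? ? [? ?].
    apply: eq_bigr => i _; rewrite ffunE /=.
    rewrite {2}rinnerC Tsym /rinner.
    by case: (inner _ _) => ? ?; case: (inner _ _).
  lra.
have /fdot_eq0/eqP : fdot q q = 0.
  by rewrite {2}qE (dotBr (@fdotC I) (@fdotD I) (@fdotZ I)) qv qp subr0.
by rewrite qE subr_eq0 => /eqP.
Qed.

(* The uniform norm bound C is what Kaplansky's density theorem would provide. *)
Definition approximable (I : finType) (v : I -> H) (T : H -> H) (C : R) : Prop :=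
  forall d, 0 < d -> exists x : A,
    [/\ star x = x, rn x <= C & forall i, rn (pi x (v i) - T (v i)) < d].

(** The projection onto [u] is approximated at [u] and at the components of the [v i] orthogonal to
    [u]. These are eigenvectors with eigenvalues 1 and 0, both fixed by 2t/(1 + t^2), so [clamp]
    preserves the approximation and makes the norm at most 1. *)
Lemma approximable_unit (I : finType) (v : I -> H) (u : H) : rn u = 1 ->
  approximable v (fun w => inner u w *: u) 1.
Proof.
move=> u1 d d0.
have uu : inner u u = 1 :> R[i] by rewrite inner_rn u1 expr1n.
pose M := \sum_i rn (v i).
have Mv i : rn (v i) <= M.
  by rewrite /M (bigD1 i) //= lerDl sumr_ge0 // => j _; exact: rn_ge0.
have M0 : 0 <= M by rewrite sumr_ge0 // => j _; exact: rn_ge0.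
(* The error at [v i] is below 4r from the orthogonal component plus at most M times 4r from the
   component along [u]. *)
pose r := d / (4 * (1 + M)).
have r0 : 0 < r by rewrite divr_gt0 // mulr_gt0 // ltr_wpDr.
have rM : 4 * r * (1 + M) = d by rewrite /r; field; rewrite gt_eqF // ltr_wpDr.
pose w i := v i - inner u (v i) *: u.
pose e : {ffun option I -> H} := [ffun k => if k is Some i then w i else u].
have [|c y|y z|x0 xs hx] :=
  @selfadjoint_density _ e (fun w => inner u w *: u) r _ _ _ r0.
- by move=> y z; rewrite innerDr scalerDl.
- by rewrite innerZr scalerA.
- rewrite /rinner innerZl innerZr -innerC.
  by case: (inner y u) => ? ?; case: (inner u z) => ? ? /=; ring.
exists (clamp x0); split; [exact: clamp_star | exact: rn_clamp |].
move=> i.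
have hu : rn (pi (clamp x0) u - u) < 4 * r.
  have := rep_clamp pi_nonzero pi_irreducible 1 u xs.
  rewrite expr1n mulr1 divff // rmorph1 scale1r => h.
  have := hx None; rewrite ffunE uu scale1r; lra.
have hw : rn (pi (clamp x0) (w i)) < 4 * r.
  have := rep_clamp pi_nonzero pi_irreducible 0 (w i) xs.
  rewrite mulr0 mul0r rmorph0 !scale0r !subr0 => h.
  have := hx (Some i); rewrite ffunE /w innerDr innerNr innerZr uu mulr1 subrr.
  by rewrite scale0r subr0 -/(w i); lra.
have -> : pi (clamp x0) (v i) - inner u (v i) *: u =
    pi (clamp x0) (w i) + inner u (v i) *: (pi (clamp x0) u - u).
  by rewrite /w !repE; lmod.
apply: le_lt_trans (rnD _ _) _; rewrite rnZ.
have h1 : normc (inner u (v i)) <= M.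
  by apply: le_trans (normc_inner_le _ _) _; rewrite u1 mul1r.
have := ler_wpM2r (rn_ge0 (pi (clamp x0) u - u)) h1.
have := rn_ge0 (pi (clamp x0) u - u); rewrite -rM; nra.
Qed.

Lemma approximable_ext (I : finType) (v : I -> H) (T T' : H -> H) (C C' : R) :
  approximable v T C -> C <= C' -> (forall i, T (v i) = T' (v i)) ->
  approximable v T' C'.
Proof.
move=> h CC TT d /h[x [xs xC hx]]; exists x; split => //.
  exact: le_trans CC.
by move=> i; rewrite -TT.
Qed.

Lemma approximableD (I : finType) (v : I -> H) (T T' : H -> H) (C C' : R) :
  approximable v T C -> approximable v T' C' ->
  approximable v (fun w => T w + T' w) (C + C').
Proof.
move=> h h' d d0; have d2 : 0 < d / 2 by lra.
have [x [xs xC hx]] := h _ d2; have [y [ys yC hy]] := h' _ d2.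
exists (x + y); split.
- by rewrite starD xs ys.
- by have := rnD x y; lra.
move=> i; rewrite repE opprD addrACA.
have := rnD (pi x (v i) - T (v i)) (pi y (v i) - T' (v i)).
by have := hx i; have := hy i; lra.
Qed.

Lemma approximableZ (I : finType) (v : I -> H) (T : H -> H) (C r : R) :
  approximable v T C -> approximable v (fun w => r%:C *: T w) (`|r| * C).
Proof.
move=> h d d0.
have r0 : 0 < `|r| + 1 by rewrite ltr_wpDl.
have [x [xs xC hx]] := h _ (divr_gt0 d0 r0).
exists (r%:C *: x); split.
- by rewrite starZc conjc_real xs.
- by rewrite rnZ normc_real ler_wpM2l.
move=> i; rewrite repE -scalerBr rnZ normc_real.
have := hx i; rewrite ltr_pdivlMr // => h1; apply: le_lt_trans h1.
by rewrite mulrC ler_wpM2l ?rn_ge0 // lerDl.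
Qed.

Lemma approximable_rank1 (I : finType) (v : I -> H) (u : H) :
  approximable v (fun w => inner u w *: u) (rn u ^+ 2).
Proof.
have [->|/eqP u0] := eqVneq u 0.
  move=> d d0; exists 0; split.
  - exact: additive_map0 (@star_additive R A).
  - by rewrite !rn0 expr0n.
  by move=> i; rewrite -(scale0r (0 : A)) repZ scale0r scaler0 subrr rn0.
have ru := rn_gt0 u0.
have u1 : rn ((rn u)^-1%:C *: u) = 1.
  by rewrite rnZ normc_real ger0_norm ?invr_ge0 ?rn_ge0 // mulVf // gt_eqF.
apply: approximable_ext (approximableZ (rn u ^+ 2) (approximable_unit v u1)) _ _.
  by rewrite mulr1 ger0_norm ?sqr_ge0.
move=> i; rewrite innerZl conjc_real !scalerA; congr (_ *: _).
have E : (rn u ^+ 2)%:C * (rn u)^-1%:C * (rn u)^-1%:C = 1 :> R[i].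
  rewrite -!rmorphM /= -[RHS](rmorph1 (real_complex R)); congr (_%:C).
  by field; rewrite gt_eqF.
by rewrite -[RHS]mul1r -E; ring.
Qed.

(** This symmetric operator sends [e] to [x]. With k = |x|, its first two terms are the difference
    of the rank-one operators of x + k e and x - k e divided by 2k, each part costing at most 2k;
    the last term costs |r| <= k. *)
Lemma approximable_symmetric (I : finType) (v : I -> H) (e x : H) (r : R) :
  rn e = 1 -> inner e x = r%:C ->
  approximable v (fun w => inner e w *: x + inner x w *: e -
    (r%:C * inner e w) *: e) (5 * rn x).
Proof.
move=> en exr; have [x0|/eqP x0] := eqVneq x 0.
  have r0 : r%:C = 0 :> R[i] by rewrite -exr x0 inner0r.
  apply: approximable_ext (approximable_rank1 v 0) _ _.
    by rewrite x0 rn0 expr0n mulr0.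
  by move=> i; rewrite x0 r0 inner0l mul0r !scale0r !scaler0 !addr0 subr0.
have k0 := rn_gt0 x0; set k := rn x in k0 *.
have rk : `|r| <= k.
  have := normc_inner_le e x; rewrite exr normc_real en mul1r; exact.
have h1 := approximable_rank1 v (x + k%:C *: e).
have h2 := approximable_rank1 v (x - k%:C *: e).
have h3 := approximable_rank1 v e.
have h := approximableD (approximableD (approximableZ ((2 * k)^-1) h1)
  (approximableZ (- (2 * k)^-1) h2)) (approximableZ (- r) h3).
have ke : rn (k%:C *: e) = k by rewrite rnZ normc_real en mulr1 gtr0_norm.
have b1 : rn (x + k%:C *: e) ^+ 2 <= 4 * k ^+ 2.
  have := rnD x (k%:C *: e); rewrite ke -/k.
  have := rn_ge0 (x + k%:C *: e); nra.
have b2 : rn (x - k%:C *: e) ^+ 2 <= 4 * k ^+ 2.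
  have := rnB x (k%:C *: e); rewrite ke -/k.
  have := rn_ge0 (x - k%:C *: e); nra.
apply: approximable_ext h _ _.
  rewrite normrN en expr1n mulr1 normrN gtr0_norm ?invr_gt0 ?mulr_gt0 //.
  have i0 : 0 <= (2 * k)^-1 by rewrite invr_ge0 mulr_ge0 // ltW.
  have := ler_wpM2l i0 b1; have := ler_wpM2l i0 b2.
  have -> : (2 * k)^-1 * (4 * k ^+ 2) = 2 * k by field; rewrite gt_eqF.
  lra.
move=> i; rewrite !innerE !conjc_real rmorphN.
have kC : k%:C != 0 :> R[i].
  by rewrite (fmorph_eq0 (real_complex R)) gt_eqF.
have -> : ((2 * k)^-1)%:C = (2 * k%:C)^-1 :> R[i].
  by rewrite fmorphV rmorphM rmorph_nat.
by lmod_eq R[i]; field.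
Qed.

(* The hypotheses on the inner products say that x = T u and y = T w for some
   self-adjoint operator T. *)
Lemma selfadjoint_correction (u w x y : H) (r s d : R) :
  rn u = 1 -> rn w = 1 -> inner u w = 0 :> R[i] ->
  inner u x = r%:C -> inner w y = s%:C -> inner u y = inner x w :> R[i] ->
  0 < d -> exists z : A, [/\ star z = z, rn z <= 10 * rn x + 5 * rn y,
    rn (pi z u - x) < d & rn (pi z w - y) < d].
Proof.
move=> u1 w1 uw ux wy uy d0.
have uu : inner u u = 1 :> R[i] by rewrite inner_rn u1 expr1n.
have ww : inner w w = 1 :> R[i] by rewrite inner_rn w1 expr1n.
have wu : inner w u = 0 :> R[i] by rewrite innerC uw conjc0.
have xu : inner x u = r%:C by rewrite innerC ux conjc_real.
have yw : inner y w = s%:C by rewrite innerC wy conjc_real.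
(* The operator attached to (u, x) already sends [w] to [inner x w *: u]; the one attached to (w,
   y') supplies the rest and kills [u]. *)
pose y' := y - inner x w *: u.
have wy' : inner w y' = s%:C by rewrite /y' innerDr innerNr innerZr wu mulr0 subr0.
pose v (b : bool) := if b then u else w.
have h := approximableD (approximable_symmetric v u1 ux)
  (approximable_symmetric v w1 wy') d0.
have [z [zs zn hz]] := h; exists z; split => //.
- have : rn y' <= rn y + rn x.
    apply: le_trans (rnB _ _) _; rewrite lerD2l rnZ u1 mulr1.
    by have := normc_inner_le x w; rewrite w1 mulr1.
  by lra.
- have := hz true; congr (rn (_ - _) < _).
  have y'u : inner y' u = 0 :> R[i].
    by rewrite innerC /y' innerDr innerNr innerZr uu mulr1 uy subrr conjc0.
  by rewrite /v uu wu xu y'u; lmod.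
- have := hz false; congr (rn (_ - _) < _).
  have y'w : inner y' w = s%:C by rewrite innerC wy' conjc_real.
  by rewrite /v uw ww y'w /y'; lmod.
Qed.

End density.

(** * Continuous selections *)

Section selection.
Variable R : realType.

Lemma sup_le_add (S S' : set R) (c : R) : S !=set0 -> has_ubound S' ->
  (forall r, S r -> exists2 r', S' r' & r <= r' + c) -> sup S <= sup S' + c.
Proof.
move=> S0 ubS' h; apply: ge_sup => // r /h[r' Sr' rr'].
by apply: le_trans rr' _; rewrite lerD2r; apply: ub_le_sup.
Qed.

Lemma well_order_total (T : eqType) (r : rel T) : well_order r ->
  (forall a b, r a b \/ r b a) /\ (forall a b, r a b -> r b a -> a = b).
Proof.
move=> wo.
have refl a : r a a.
  have [|z [[za zmin] _]] := wo (pred1 a); first by exists a; rewrite inE.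
  by move: za zmin; rewrite inE => /eqP -> /(_ a); apply; rewrite inE.
split=> a b.
  have [|z [[zab zmin] _]] := wo (pred2 a b); first by exists a; rewrite inE eqxx.
  move: zab zmin; rewrite inE => /orP[] /eqP -> zmin.
    by left; apply: zmin; rewrite inE eqxx orbT.
  by right; apply: zmin; rewrite inE eqxx.
move=> ab ba.
have [|z [_ zuniq]] := wo (pred2 a b); first by exists a; rewrite inE eqxx.
have -> : a = z.
  by apply/esym/zuniq; split; [|move=> x]; rewrite inE ?eqxx // => /orP[] /eqP ->.
apply: zuniq; split; [|move=> x]; rewrite inE ?eqxx ?orbT // => /orP[] /eqP -> //.
Qed.

Variables (T : Type) (E : normedModType R[i]) (X : set T) (d : T -> T -> R).
Hypothesis dxx : forall x, d x x = 0.
Hypothesis dC : forall x y, d x y = d y x.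
Hypothesis d_triangle : forall x y z, d x z <= d x y + d y z.

Lemma dist_ge0 x y : 0 <= d x y.
Proof. by have := d_triangle x y x; rewrite dxx (dC y); lra. Qed.

Variable Phi : T -> E -> Prop.
Hypothesis Phi_convex : forall x a b (t : R), X x -> Phi x a -> Phi x b ->
  0 <= t -> t <= 1 -> Phi x (t%:C *: a + (1 - t)%:C *: b).
Hypothesis Phi_nonempty : forall x, X x -> exists a, Phi x a.
Hypothesis Phi_open : forall x a, X x -> Phi x a ->
  exists2 r : R, 0 < r & forall y, X y -> d x y < r -> Phi y a.

Definition safe_radii (a : E) (x : T) : set R :=
  [set r | 0 <= r <= 1 /\ forall y, X y -> d x y < r -> Phi y a].

(** The distance from [x] to the points of [X] at which [a] is not admissible, truncated at 1. *)
Definition depth (a : E) (x : T) : R := sup (safe_radii a x).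

Lemma safe_radii0 a x : safe_radii a x 0.
Proof.
by split; [rewrite lexx ler01|move=> y _; rewrite ltNge dist_ge0].
Qed.

Lemma safe_radii_ub a x : has_ubound (safe_radii a x).
Proof. by exists 1 => r [/andP[]]. Qed.

Lemma depth_ge0 a x : 0 <= depth a x.
Proof. by apply: ub_le_sup; [exact: safe_radii_ub | exact: safe_radii0]. Qed.

Lemma depth_le1 a x : depth a x <= 1.
Proof.
by apply: ge_sup => [|r [/andP[]] //]; exists 0; exact: safe_radii0.
Qed.

Lemma depth_lipschitz a x y : depth a x <= depth a y + d x y.
Proof.
apply: sup_le_add (safe_radii_ub a y) _; first by exists 0; exact: safe_radii0.
move=> r [/andP[r0 r1] hr]; have [rd|rd] := leP (d x y) r.
  exists (r - d x y); last by rewrite subrK.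
  split; first by rewrite subr_ge0 rd /= (le_trans _ r1) // gerBl dist_ge0.
  move=> z Xz yz; apply: hr => //; have := d_triangle x y z; lra.
by exists 0; [exact: safe_radii0 | rewrite add0r ltW].
Qed.

Lemma depth_gt0 a x : X x -> 0 < depth a x -> Phi x a.
Proof.
move=> Xx h; have [|r [_ hr] r0] := sup_gt _ h.
  by exists 0; exact: safe_radii0.
by apply: hr; rewrite ?dxx.
Qed.

Lemma Phi_depth a x : X x -> Phi x a -> 0 < depth a x.
Proof.
move=> Xx /(Phi_open Xx)[r r0 hr].
apply: (@lt_le_trans _ _ (Num.min r 1)); first by rewrite lt_min r0 ltr01.
apply: ub_le_sup; first exact: safe_radii_ub.
split; first by rewrite le_min ltW //= ler01 /= ge_min lexx orbT.
by move=> y Xy; rewrite lt_min => /andP[h _]; exact: hr.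
Qed.

Let prec : rel E := sval (well_ordering_principle E).

Lemma prec_total a b : prec a b \/ prec b a.
Proof. by have [h _] := well_order_total (svalP (well_ordering_principle E)). Qed.

Lemma prec_anti a b : prec a b -> prec b a -> a = b.
Proof.
by have [_ h] := well_order_total (svalP (well_ordering_principle E)); exact: h.
Qed.

(** Including 0 keeps the set nonempty for the first element of the well-order and makes its
    supremum nonnegative. *)
Definition earlier_depths (a : E) (x : T) : set R :=
  [set r | r = 0 \/ exists2 b, prec b a /\ b <> a & r = depth b x].

Definition earlier (a : E) (x : T) : R := sup (earlier_depths a x).

Definition excess (a : E) (x : T) : R := depth a x - earlier a x.

Lemma earlier_depths_ub a x : has_ubound (earlier_depths a x).
Proof. by exists 1 => r [->|[b _ ->]]; [exact: ler01 | exact: depth_le1]. Qed.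

Lemma earlier_ge0 a x : 0 <= earlier a x.
Proof. by apply: ub_le_sup; [exact: earlier_depths_ub | left]. Qed.

Lemma earlier_lipschitz a x y : earlier a x <= earlier a y + d x y.
Proof.
apply: sup_le_add (earlier_depths_ub a y) _; first by exists 0; left.
move=> r [->|[b ba ->]]; first by exists 0; [left | rewrite add0r dist_ge0].
by exists (depth b y); [right; exists b | exact: depth_lipschitz].
Qed.

Lemma excess_lipschitz a x y : excess a x <= excess a y + 2 * d x y.
Proof.
have := depth_lipschitz a x y; have := earlier_lipschitz a y x.
rewrite (dC y) /excess; lra.
Qed.

Lemma excess_le1 a x : excess a x <= 1.
Proof. by have := depth_le1 a x; have := earlier_ge0 a x; rewrite /excess; lra. Qed.

Definition max_excess (x : T) : R := sup [set excess a x | a in [set: E]].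

Lemma max_excess_ub x : has_ubound [set excess a x | a in [set: E]].
Proof. by exists 1 => _ [a _ <-]; exact: excess_le1. Qed.

Lemma max_excess_lipschitz x y : max_excess x <= max_excess y + 2 * d x y.
Proof.
apply: sup_le_add (max_excess_ub y) _; first by exists (excess 0 x), 0.
by move=> _ [a _ <-]; exists (excess a y); [exists a|exact: excess_lipschitz].
Qed.

(* The first a (for the well-order) such that Phi x a has no
   earlier competitor. *)
Lemma max_excess_gt0 x : X x -> 0 < max_excess x.
Proof.
move=> Xx.
have [|a [[/asboolP a0 amin] _]] := svalP (well_ordering_principle E)
    (fun a => `[< 0 < depth a x >]).
  by have [a /(Phi_depth Xx) ha] := Phi_nonempty Xx; exists a; apply/asboolP.
have ea : earlier a x = 0.
  apply/eqP; rewrite eq_le earlier_ge0 andbT; apply: ge_sup; first by exists 0; left.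
  move=> r [->//|[b [ba bna] ->]]; rewrite leNgt; apply/negP => b0.
  by apply: bna; apply: prec_anti => //; apply: amin; apply/asboolP.
apply: (@lt_le_trans _ _ (excess a x)); first by rewrite /excess ea subr0.
by apply: ub_le_sup; [exact: max_excess_ub | exists a].
Qed.

(** If a precedes b and b has excess above c, then depth b > depth a + c. So the integer part of
    depth/c is injective on such elements, and it is bounded because depths are at most 1. *)
Lemma excess_finite x (c : R) : 0 < c ->
  exists2 l : seq E, uniq l & forall a, c < excess a x -> a \in l.
Proof.
move=> c0; pose k a := Num.truncn (depth a x / c).
pose pick n := xget 0 [set a | c < excess a x /\ k a = n].
pose N := (Num.truncn c^-1).+1.
exists (undup [seq pick n | n <- iota 0 N]); first exact: undup_uniq.
move=> a ha; rewrite mem_undup; apply/mapP; exists (k a).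
  rewrite mem_iota add0n /N ltnS; apply: le_truncn.
  by rewrite ler_pdivrMr // mulVf ?depth_le1 // gt_eqF.
rewrite /pick; case: xgetP => [b _ [hb kb]|/(_ a)]; last by case.
have kdiff a' b' : c < excess b' x -> prec a' b' -> a' <> b' -> (k a' < k b')%N.
  move=> hb' ab anb.
  have : depth a' x <= earlier b' x.
    by apply: ub_le_sup; [exact: earlier_depths_ub | right; exists a'].
  rewrite /excess in hb' => e.
  have : depth a' x / c + 1 <= depth b' x / c.
    have -> : depth a' x / c + 1 = (depth a' x + c) / c.
      by field; rewrite gt_eqF.
    by rewrite ler_pM2r ?invr_gt0 //; lra.
  have : (k a')%:R <= depth a' x / c by rewrite truncn_le divr_ge0 ?depth_ge0 // ltW.
  by rewrite /k truncn_gt_nat -natr1; lra.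
have [//|/eqP anb] := eqVneq a b.
have [ab|ba] := prec_total a b.
  by have := kdiff _ _ hb ab anb; rewrite kb ltnn.
by have := kdiff _ _ ha ba (fun e => anb (esym e)); rewrite kb ltnn.
Qed.

(** Cutting at half the maximal excess leaves finitely many positive weights on [X], and at least
    one. *)
Definition bump (a : E) (x : T) : R := Num.max 0 (excess a x - max_excess x / 2).

Lemma bump_ge0 a x : 0 <= bump a x.
Proof. by rewrite le_max lexx. Qed.

Lemma bump_lipschitz a x y : `|bump a x - bump a y| <= 3 * d x y.
Proof.
have h u v : bump a u <= bump a v + 3 * d u v.
  have := excess_lipschitz a u v; have := max_excess_lipschitz v u.
  rewrite (dC v) /bump => h1 h2; rewrite ge_max; apply/andP; split.
    rewrite addr_ge0 ?mulr_ge0 ?dist_ge0 //; exact: bump_ge0.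
  have : excess a v - max_excess v / 2 <= Num.max 0 (excess a v - max_excess v / 2).
    by rewrite le_max lexx orbT.
  lra.
rewrite ler_norml; have := h x y; have := h y x; rewrite (dC y).
by move=> h1 h2; apply/andP; split; lra.
Qed.

Lemma bump_gt0 a x : (0 < bump a x) = (max_excess x / 2 < excess a x).
Proof. by rewrite lt_max ltxx subr_gt0. Qed.

Lemma bump_Phi a x : X x -> 0 < bump a x -> Phi x a.
Proof.
move=> Xx; rewrite bump_gt0 => h; apply: depth_gt0 => //.
have := max_excess_gt0 Xx; have := earlier_ge0 a x; rewrite /excess in h; lra.
Qed.

Definition average (l : seq E) (x : T) : E :=
  (\sum_(a <- l) bump a x)^-1%:C *: \sum_(a <- l) (bump a x)%:C *: a.

(** Any list containing the support gives the same average, so one list can serve a whole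
    neighbourhood. *)
Definition covers (l : seq E) (x : T) : Prop :=
  uniq l /\ forall a, 0 < bump a x -> a \in l.

Lemma average_eq l l' x : covers l x -> covers l' x -> average l x = average l' x.
Proof.
suff h (V : nmodType) (F : E -> V) : (forall a, bump a x = 0 -> F a = 0) ->
    covers l x -> covers l' x -> \sum_(a <- l) F a = \sum_(a <- l') F a.
  move=> cl cl'; rewrite /average; congr ((_^-1)%:C *: _); apply: h => // a -> //.
  by rewrite scale0r.
move=> F0 [ul hl] [ul' hl'].
have red k : \sum_(a <- k) F a = \sum_(a <- [seq a <- k | 0 < bump a x]) F a.
  rewrite big_filter [RHS]big_mkcond /=; apply: eq_bigr => a _; case: ifPn => //.
  rewrite lt_def bump_ge0 andbT negbK => /eqP; exact: F0.
rewrite red [RHS]red; apply: perm_big; apply: uniq_perm; rewrite ?filter_uniq //.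
move=> a; rewrite !mem_filter; case: ltP => //= b0.
by rewrite hl // hl'.
Qed.

Lemma average_Phi l x : X x -> 0 < \sum_(a <- l) bump a x -> Phi x (average l x).
Proof.
move=> Xx; rewrite /average; elim: l => [|a l IH]; first by rewrite big_nil ltxx.
rewrite !big_cons.
set S := \sum_(b <- l) bump b x in IH *; set W := \sum_(b <- l) _ *: b in IH *.
have S0 : 0 <= S by rewrite sumr_ge0 // => b _; exact: bump_ge0.
have [b0|b0] := ltP 0 (bump a x); last first.
  have -> : bump a x = 0 by apply/eqP; rewrite eq_le b0 bump_ge0.
  by rewrite !add0r scale0r add0r.
have Pa := bump_Phi Xx b0.
have [Spos _|Sneg _] := ltP 0 S.
  pose t := bump a x / (bump a x + S).
  have bS : 0 < bump a x + S by rewrite addr_gt0.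
  have t0 : 0 <= t by rewrite divr_ge0 // ltW.
  have t1 : t <= 1 by rewrite ler_pdivrMr // mul1r lerDl.
  have := Phi_convex Xx Pa (IH Spos) t0 t1; congr (Phi x _).
  have -> : 1 - t = S / (bump a x + S) by rewrite /t; field; rewrite gt_eqF.
  rewrite scalerDr !scalerA -!rmorphM /=; congr (_%:C *: _ + _%:C *: _).
    by rewrite mulrC.
  by rewrite mulrAC mulfV ?mul1r // gt_eqF.
have Sz : S = 0 by apply/eqP; rewrite eq_le Sneg.
have Wz : W = 0.
  rewrite /W big_seq big1 // => b bl.
  have : bump b x <= S.
    rewrite /S (big_rem b bl) /= lerDl sumr_ge0 // => c _; exact: bump_ge0.
  rewrite Sz => bb; have -> : bump b x = 0 by apply/eqP; rewrite eq_le bb bump_ge0.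
  by rewrite scale0r.
rewrite Sz Wz !addr0 scalerA -rmorphM /= mulVf ?gt_eqF //.
by rewrite rmorph1 scale1r.
Qed.

Lemma average_continuous l x (e : R) : X x -> 0 < \sum_(a <- l) bump a x ->
  0 < e -> exists2 r : R, 0 < r &
    forall y, d x y < r -> rn (average l x - average l y) < e.
Proof.
move=> Xx S0 e0; set S := \sum_(a <- l) bump a x in S0.
have [c cdef] : exists c, c = average l x by exists (average l x).
rewrite -cdef; pose n := (size l)%:R : R.
pose K := \sum_(a <- l) rn (a - c).
have K0 : 0 <= K by rewrite sumr_ge0 // => a _; exact: rn_ge0.
have n0 : 0 <= n by [].
(* The first bound keeps the total weight at [y] above S/2; the second bounds the weighted sum of
   the vectors a - c, whose weights change by at most 3r. *)
pose r := Num.min (S / (2 * (3 * n + 1))) (e * S / (2 * (3 * K + 1))).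
have r0 : 0 < r by rewrite lt_min !divr_gt0 ?mulr_gt0 // ltr_wpDl // mulr_ge0.
exists r => // y xy.
have {}xy : d x y <= r by exact: ltW.
have rS : r * (3 * n + 1) <= S / 2.
  have : r <= S / (2 * (3 * n + 1)) by rewrite ge_min lexx.
  rewrite ler_pdivlMr ?mulr_gt0 ?ltr_wpDl ?mulr_ge0 //; lra.
have rK : r * (3 * K + 1) <= e * S / 2.
  have : r <= e * S / (2 * (3 * K + 1)) by rewrite ge_min lexx orbT.
  rewrite ler_pdivlMr ?mulr_gt0 ?ltr_wpDl ?mulr_ge0 //; lra.
set N := \sum_(a <- l) bump a y.
have NS : S - N <= r * (3 * n).
  rewrite -sumrB; apply: le_trans (_ : \sum_(a <- l) 3 * r <= _).
    apply: ler_sum => a _; have := bump_lipschitz a x y.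
    by rewrite ler_norml => /andP[_]; lra.
  by rewrite big_const_seq count_predT iter_addr_0 -mulr_natr -/n; lra.
have N0 : S / 2 <= N by have := ltW r0; lra.
have Np : 0 < N by lra.
have cE : S%:C *: c = \sum_(a <- l) (bump a x)%:C *: a.
  by rewrite cdef /average -/S scalerA -rmorphM /= mulfV ?rmorph1 ?scale1r // gt_eqF.
have dE : N%:C *: (c - average l y) =
    \sum_(a <- l) (bump a x - bump a y)%:C *: (a - c).
  rewrite scalerBr /average -/N scalerA -rmorphM /= mulfV ?gt_eqF //.
  rewrite rmorph1 scale1r.
  have -> : N%:C *: c = S%:C *: c - (S - N)%:C *: c by rewrite rmorphB; lmod.
  rewrite cE /S /N -sumrB rmorph_sum scaler_suml -!sumrB.
  by apply: eq_bigr => a _; rewrite rmorphB; lmod.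
have : N * rn (c - average l y) <= 3 * r * K.
  have -> : N * rn (c - average l y) = rn (N%:C *: (c - average l y)).
    by rewrite rnZ normc_real gtr0_norm.
  rewrite dE /K mulr_sumr.
  elim: (l) => [|a k IH]; first by rewrite !big_nil rn0.
  rewrite !big_cons; apply: le_trans (rnD _ _) _; apply: lerD => //.
  rewrite rnZ normc_real ler_wpM2r ?rn_ge0 //.
  by apply: le_trans (bump_lipschitz _ _ _) _; rewrite ler_wpM2l.
move=> h; rewrite -(ltr_pM2l Np); apply: le_lt_trans h _.
apply: lt_le_trans (_ : r * (3 * K + 1) <= _); first by lra.
apply: le_trans rK _; nra.
Qed.

Lemma sum_bump_gt0 l x : X x -> covers l x -> 0 < \sum_(a <- l) bump a x.
Proof.
move=> Xx [_ cl]; have s0 := max_excess_gt0 Xx.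
have [||_ [a _ <-] ha] := @sup_adherent _ [set excess a x | a in [set: E]]
    (max_excess x / 2).
- by rewrite divr_gt0.
- by split; [exists (excess 0 x), 0 | exact: max_excess_ub].
have ba : 0 < bump a x.
  by rewrite bump_gt0; move: ha; rewrite -/(max_excess x); lra.
rewrite (big_rem a (cl a ba)) /= ltr_wpDr // sumr_ge0 // => b _.
exact: bump_ge0.
Qed.

(** The chosen list may vary from point to point, but near [x] the finite list of elements of excess
    above a quarter of the maximum at [x] covers every support. *)
Lemma continuous_selection : exists f : T -> E,
  (forall x, X x -> Phi x (f x)) /\
  (forall x, X x -> forall e : R, 0 < e -> exists2 r : R, 0 < r &
     forall y, X y -> d x y < r -> rn (f x - f y) < e).
Proof.
have hl x : exists l, X x -> covers l x.
  have [Xx|nX] := pselect (X x); last by exists [::].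
  have [l ul hl] := excess_finite x (divr_gt0 (max_excess_gt0 Xx) (ltr0Sn R 1)).
  by exists l => _; split => // a; rewrite bump_gt0; exact: hl.
exists (fun x => average (sval (cid (hl x))) x); split.
  move=> x Xx; case: cid => l /= /(_ Xx) cl.
  by apply: average_Phi => //; exact: sum_bump_gt0.
move=> x Xx e e0; have s0 := max_excess_gt0 Xx.
have c0 : 0 < max_excess x / 4 by lra.
have [l ul cl] := excess_finite x c0.
have lx : covers l x.
  by split=> // a; rewrite bump_gt0 => h; apply: cl; lra.
have [r r0 hr] := average_continuous Xx (sum_bump_gt0 Xx lx) e0.
(* A positive bump at [y] gives excess at [x] above [max_excess x]/2 - 3 [d x y], which exceeds
   [max_excess x]/4. *)
exists (Num.min r (max_excess x / 12)); first by rewrite lt_min r0 /=; lra.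
move=> y Xy; rewrite lt_min => /andP[yr ys].
have ly : covers l y.
  split=> // a; rewrite bump_gt0 => h; apply: cl.
  have := excess_lipschitz a y x; have := max_excess_lipschitz x y.
  rewrite (dC y); lra.
rewrite (@average_eq _ l x) //; last by case: cid => ? /=; exact.
rewrite (@average_eq _ l y) //; last by case: cid => ? /=; exact.
exact: hr.
Qed.

End selection.

(** * Continuous choice of a reflection for each orthonormal pair *)

Section reflection_selection.
Variables (R : realType) (A : unitalCStarType R) (H : hilbertType R).
Variable pi : representation A H.
Hypothesis pi_nonzero : nonzero_rep pi.
Hypothesis pi_irreducible : irreducible_rep pi.
Local Notation "a ** b" := (cstar_mul a b) (at level 40, left associativity).
Local Notation e1 := (cstar_one : A).

Definition orthonormal_pairs : set (H * H) :=
  [set p | [/\ rn p.1 = 1, rn p.2 = 1 & inner p.1 p.2 = 0 :> R[i]]].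

Definition pair_dist (p q : H * H) : R := rn (p.1 - q.1) + rn (p.2 - q.2).

Definition eps_continuous (f : H * H -> A) : Prop :=
  forall p, orthonormal_pairs p -> forall e : R, 0 < e -> exists2 r : R, 0 < r &
    forall q, orthonormal_pairs q -> pair_dist p q < r -> rn (f p - f q) < e.

Definition almost_reflection (e : R) (a : A) (p : H * H) : Prop :=
  [/\ star a = a, rn (pi a p.1 - p.1) < e & rn (pi a p.2 + p.2) < e].

Definition good_approximation (e : R) (f : H * H -> A) : Prop :=
  (forall p, orthonormal_pairs p -> almost_reflection e (f p) p) /\
  eps_continuous f.

Lemma convex_rn (E : normedModType R[i]) (x y : E) (t e : R) :
  0 <= t -> t <= 1 -> rn x < e -> rn y < e ->
  rn (t%:C *: x + (1 - t)%:C *: y) < e.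
Proof.
move=> t0 t1 xe ye; apply: le_lt_trans (rnD _ _) _.
rewrite !rnZ !normc_real !ger0_norm ?subr_ge0 //.
have [->|/eqP tn0] := eqVneq t 0; first by rewrite mul0r add0r subr0 mul1r.
have tp : 0 < t by rewrite lt_def t0 andbT; apply/eqP.
have h1 : t * rn x < t * e by rewrite ltr_pM2l.
have h2 : (1 - t) * rn y <= (1 - t) * e by rewrite ler_wpM2l ?subr_ge0 // ltW.
lra.
Qed.

Lemma pi_moved (a : A) (x y : H) (c : R) : normc c%:C = 1 ->
  rn ((pi a x + c%:C *: x) - (pi a y + c%:C *: y)) <= (rn a + 1) * rn (x - y).
Proof.
move=> c1.
have -> : pi a x + c%:C *: x - (pi a y + c%:C *: y) = pi a (x - y) + c%:C *: (x - y).
  by rewrite !repE; lmod.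
have := rnD (pi a (x - y)) (c%:C *: (x - y)); rewrite rnZ c1.
have := rep_contraction pi_nonzero pi_irreducible a (x - y); lra.
Qed.

(** The selection theorem is applied to the e/2-almost reflections within 15 e of [f p]. Such
    elements exist because the two errors of [f p] are below e, so the correction has norm below 10
    e + 5 e. *)
Lemma refine_approximation (e : R) (f : H * H -> A) : 0 < e ->
  good_approximation e f -> exists f', good_approximation (e / 2) f' /\
    forall p, orthonormal_pairs p -> rn (f' p - f p) < 15 * e.
Proof.
move=> e0 [fr fc]; have e2 : 0 < e / 2 by lra.
pose Phi p a := almost_reflection (e / 2) a p /\ rn (a - f p) < 15 * e.
have [||p q s|p a b t Xp|p Xp|p a Xp|f' [hf' cf']] :=
  @continuous_selection R _ A orthonormal_pairs pair_dist _ _ _ Phi.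
- by move=> p; rewrite /pair_dist !subrr !rn0 addr0.
- by move=> p q; rewrite /pair_dist rn_dist (rn_dist p.2).
- rewrite /pair_dist; have := rn_dist_trans q.1 p.1 s.1.
  by have := rn_dist_trans q.2 p.2 s.2; lra.
- move=> [[as_ a1 a2] af] [[bs b1 b2] bf] t0 t1; split; last first.
    have -> : t%:C *: a + (1 - t)%:C *: b - f p =
        t%:C *: (a - f p) + (1 - t)%:C *: (b - f p).
      by rewrite rmorphB rmorph1; lmod.
    exact: convex_rn.
  split.
  + by rewrite !starE !conjc_real as_ bs.
  + have -> : pi (t%:C *: a + (1 - t)%:C *: b) p.1 - p.1 =
        t%:C *: (pi a p.1 - p.1) + (1 - t)%:C *: (pi b p.1 - p.1).
      by rewrite !repE rmorphB rmorph1; lmod.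
    exact: convex_rn.
  + have -> : pi (t%:C *: a + (1 - t)%:C *: b) p.2 + p.2 =
        t%:C *: (pi a p.2 + p.2) + (1 - t)%:C *: (pi b p.2 + p.2).
      by rewrite !repE rmorphB rmorph1; lmod.
    exact: convex_rn.
- have [p1 p2 p12] := Xp; have [fs f1 f2] := fr p Xp.
  have sym v w : inner v (pi (f p) w) = inner (pi (f p) v) w :> R[i].
    by rewrite rep_adjoint fs.
  (* Self-adjointness of [f p] makes the diagonal coefficients real, as [selfadjoint_correction]
     requires. *)
  have real v : inner v (pi (f p) v) = (rinner v (pi (f p) v))%:C.
    rewrite /rinner; have : inner v (pi (f p) v) = conjc (inner v (pi (f p) v)).
      by rewrite -innerC -sym.
    case: (inner _ _) => x y [] /= yN; congr (_ +i* _); lra.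
  have p21 : inner p.2 p.1 = 0 :> R[i] by rewrite innerC p12 conjc0.
  have [||||z [zs zn z1 z2]] := @selfadjoint_correction R A H pi pi_nonzero
     pi_irreducible p.1 p.2 (p.1 - pi (f p) p.1) (- p.2 - pi (f p) p.2)
     (1 - rinner p.1 (pi (f p) p.1)) (- 1 - rinner p.2 (pi (f p) p.2)) (e / 2) p1 p2 p12.
  + by rewrite innerDr innerNr inner_rn p1 expr1n real rmorphB.
  + by rewrite innerDr !innerNr inner_rn p2 expr1n real rmorphB rmorphN.
  + by rewrite innerDr !innerNr innerDl innerNl p12 -sym; ring.
  + exact: e2.
  exists (f p + z); split; last first.
    rewrite addrAC subrr add0r; apply: le_lt_trans zn _.
    rewrite -opprD rnN [p.2 + _]addrC (rn_dist p.1); lra.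
  split; first by rewrite starD fs zs.
  + by move: z1; congr (rn _ < _); rewrite repD; lmod.
  + by move: z2; congr (rn _ < _); rewrite repD; lmod.
- move=> [[as_ a1 a2] af].
  pose g := Num.min (e / 2 - rn (pi a p.1 - p.1)) (e / 2 - rn (pi a p.2 + p.2)).
  have g0 : 0 < g by rewrite lt_min !subr_gt0 a1 a2.
  have d0 : 0 < 15 * e - rn (a - f p) by rewrite subr_gt0.
  have [r r0 hr] := fc p Xp _ d0.
  have k0 : 0 < rn a + 1 by rewrite ltr_wpDl ?rn_ge0.
  exists (Num.min r (g / (rn a + 1))); first by rewrite lt_min r0 divr_gt0.
  move=> q Xq; rewrite lt_min => /andP[qr qg].
  rewrite ltr_pdivlMr // in qg.
  have d1 : rn (p.1 - q.1) <= pair_dist p q by rewrite lerDl rn_ge0.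
  have d2 : rn (p.2 - q.2) <= pair_dist p q by rewrite lerDr rn_ge0.
  have g1 : g <= e / 2 - rn (pi a p.1 - p.1) by rewrite ge_min lexx.
  have g2 : g <= e / 2 - rn (pi a p.2 + p.2) by rewrite ge_min lexx orbT.
  have m1 := @pi_moved a q.1 p.1 (-1); have m2 := @pi_moved a q.2 p.2 1.
  rewrite !rmorphN !rmorph1 !scaleN1r normcN normc1 in m1.
  rewrite !rmorph1 !scale1r normc1 in m2.
  have {}m1 := m1 erefl; have {}m2 := m2 erefl.
  rewrite (rn_dist q.1) in m1; rewrite (rn_dist q.2) in m2.
  have l1 := ler_wpM2l (ltW k0) d1; have l2 := ler_wpM2l (ltW k0) d2.
  split; last first.
    have := hr q Xq qr; have := rn_dist_trans (f p) a (f q); lra.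
  split => //.
  + have := rn_dist_trans (pi a p.1 - p.1) (pi a q.1 - q.1) 0; rewrite !subr0; lra.
  + have := rn_dist_trans (pi a p.2 + p.2) (pi a q.2 + q.2) 0; rewrite !subr0; lra.
exists f'; split; last by move=> p /hf'[].
by split => // p /hf'[].
Qed.

Lemma zero_good : good_approximation 2 (fun=> 0).
Proof.
split; last by move=> p _ e e0; exists 1 => // q _ _; rewrite subrr rn0.
move=> p [p1 p2 _].
have z v : pi 0 v = 0 by rewrite -(scale0r (0 : A)) repZ scale0r.
split; first exact: additive_map0 (@star_additive R A).
- by rewrite z sub0r rnN p1; lra.
- by rewrite z add0r p2; lra.
Qed.

Fixpoint tolerance (n : nat) : R := if n is m.+1 then tolerance m / 2 else 2.

Lemma tolerance_gt0 n : 0 < tolerance n.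
Proof. by elim: n => //= n IH; lra. Qed.

Lemma tolerance_small (e : R) : 0 < e -> exists n, tolerance n < e.
Proof.
move=> e0; have h n : tolerance n * n.+1%:R <= 2.
  elim: n => [|n IH] /=; first by rewrite mulr1.
  have := tolerance_gt0 n; have := ler0n R n.
  by move: IH; rewrite -[n.+2%:R]natr1 -[n.+1%:R]natr1; nra.
exists (Num.truncn (2 / e)).
have := truncnS_gt (2 / e); rewrite ltr_pdivrMr // => h2.
have := h (Num.truncn (2 / e)); have := tolerance_gt0 (Num.truncn (2 / e)).
move: h2; move: (tolerance _) (_.+1%:R : R) => x y *; nra.
Qed.

Lemma reflection_selection : exists c : H * H -> A,
  (forall p, orthonormal_pairs p ->
     [/\ star (c p) = c p, pi (c p) p.1 = p.1 & pi (c p) p.2 = - p.2]) /\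
  eps_continuous c.
Proof.
(* Each iterate carries its approximation property, from which the next one is chosen. *)
pose F := fix F n : {f | good_approximation (tolerance n) f} :=
  match n return {f | good_approximation (tolerance n) f} with
  | 0%N => exist _ _ zero_good
  | m.+1 => let s := cid (refine_approximation (tolerance_gt0 m) (svalP (F m))) in
            exist _ (sval s) (proj1 (svalP s))
  end.
pose f n := sval (F n).
have fgood n : good_approximation (tolerance n) (f n) := svalP (F n).
have fstep n p : orthonormal_pairs p -> rn (f n.+1 p - f n p) < 15 * tolerance n.
  exact: (proj2 (svalP (cid (refine_approximation (tolerance_gt0 n) (svalP (F n)))))).
clearbody f; clear F.
(* As tolerances halve, the increment of [s] is exactly the step bound 15 [tolerance n]. *)
pose s n := - (30 * tolerance n).
have inc p n : orthonormal_pairs p -> rn (f n.+1 p - f n p) <= s n.+1 - s n.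
  by move=> /fstep h; have := h n; rewrite /s /=; lra.
have s0 n : s n <= 0 by have := tolerance_gt0 n; rewrite /s; lra.
have hl p : exists l, orthonormal_pairs p -> rlim (fun n => f n p) l.
  have [Xp|nX] := pselect (orthonormal_pairs p); last by exists 0.
  have [l hl] := @rlim_increments R A (fun n => f n p) s 0 (fun n => inc p n Xp) s0.
  by exists l.
pose c p := sval (cid (hl p)).
have cl p : orthonormal_pairs p -> rlim (fun n => f n p) (c p).
  by rewrite /c; case: cid.
have cb p n : orthonormal_pairs p -> rn (c p - f n p) <= 30 * tolerance n.
  move=> Xp; have := rlim_increments_bound (fun n => inc p n Xp) s0 (cl p Xp) n.
  by rewrite /s; lra.
exists c; split; last first.
  (* This makes the uniform distance 30 [tolerance n] to the limit less than e/3. *)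
  move=> p Xp e e0; have [|n hn] := @tolerance_small (e / 90); first by lra.
  have e3 : 0 < e / 3 by lra.
  have [r r0 hr] := (fgood n).2 p Xp _ e3; exists r => // q Xq pq.
  have := hr q Xq pq; have := cb p n Xp; have := cb q n Xq.
  have := rn_dist_trans (f n p) (c p) (c q).
  by have := rn_dist_trans (f n q) (f n p) (c q); rewrite (rn_dist (f n q)); lra.
move=> p Xp; have [p1 p2 _] := Xp.
have key (x : H) : rn x = 1 -> forall n, rn (pi (c p) x - pi (f n p) x) <=
    30 * tolerance n.
  move=> x1 n; rewrite -repB; apply: le_trans (cb p n Xp).
  by have := rep_contraction pi_nonzero pi_irreducible (c p - f n p) x; rewrite x1 mulr1.
split.
- apply: rlim_unique (cl p Xp).
  have := rlim_op (@star_additive R A) (C := 1) _ (cl p Xp).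
  have sC a : rn (star a : A) <= 1 * rn a by rewrite mul1r rn_star.
  move=> /(_ sC); congr (rlim _ _); apply/funext => n.
  by have [h _ _] := (fgood n).1 p Xp.
- apply: rn_le_eps => e e0; have [|n hn] := @tolerance_small (e / 31); first by lra.
  have [_ h _] := (fgood n).1 p Xp; have := key _ p1 n.
  by have := rn_dist_trans (pi (f n p) p.1) (pi (c p) p.1) p.1; lra.
- apply: rn_le_eps => e e0; have [|n hn] := @tolerance_small (e / 31); first by lra.
  have [_ _ h] := (fgood n).1 p Xp; have := key _ p2 n.
  have := rn_dist_trans (pi (f n p) p.2) (pi (c p) p.2) (- p.2).
  by rewrite opprK; lra.
Qed.

End reflection_selection.

(** * Rotations *)

Section transition.
Variables (R : realType) (A : unitalCStarType R) (H : hilbertType R).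
Variable pi : representation A H.
Hypothesis pi_nonzero : nonzero_rep pi.
Hypothesis pi_irreducible : irreducible_rep pi.
Local Notation "a ** b" := (cstar_mul a b) (at level 40, left associativity).
Local Notation e1 := (cstar_one : A).

(** Let r be the root and w = r v - k v. Then (r + k) w = 0, so 1 - r multiplies w by 1 + k > 1; but
    |1 - r| <= 1, hence w = 0. This selects the positive root. *)
Lemma rep_sqrt1m (x : A) (k : R) (v : H) : rn x <= 1 -> 0 < k ->
  pi x v = (1 - k ^+ 2)%:C *: v -> pi (sqrt1m x) v = k%:C *: v.
Proof.
move=> x1 k0 xv; have rr := sqrt1mE x1; have r1 := sqrt1m_dist1 x1.
move: (sqrt1m x) rr r1 => r rr r1.
have [w wE] : exists w, w = pi r v - k%:C *: v by exists (pi r v - k%:C *: v).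
have rw : pi r w = - (k%:C *: w).
  have := congr1 (fun a => pi a v) rr; rewrite repM repB rep_one // xv => rrv.
  rewrite wE !repE rrv rmorphB rmorph1 rmorphXn; lmod.
have : (1 + k) * rn w <= rn w.
  have -> : (1 + k) * rn w = rn (pi (e1 - r) w).
    rewrite repB rep_one // rw.
    have -> : w - - (k%:C *: w) = (1 + k)%:C *: w by rewrite rmorphD rmorph1; lmod.
    by rewrite rnZ normc_real gtr0_norm // addr_gt0.
  apply: le_trans (rep_contraction pi_nonzero pi_irreducible _ _) _.
  by rewrite ler_piMl ?rn_ge0.
have := rn_ge0 w; move=> w0 h.
have /rn_eq0/eqP : rn w = 0 by apply/eqP; rewrite eq_le w0 andbT; nra.
by rewrite wE subr_eq0 => /eqP.
Qed.

(* The unitary exp(2i arcsin b), as the square of exp(i arcsin b). *)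
Definition half_rotation (b : A) : A := sqrt1m (b ** b) + iC *: b.
Definition rotation (b : A) : A := half_rotation b ** half_rotation b.

Lemma rotation_unitary (b : A) : star b = b -> rn b <= 1 ->
  unitary_group A (rotation b).
Proof.
move=> bs b1; have [h1 h2] := half_angle_unitary bs b1.
rewrite /unitary_group /= /rotation starM -/(half_rotation b) in h1 h2 *.
split.
  by rewrite -cstar_mulA (cstar_mulA (star _) _ (half_rotation b)) h1 cstar_mul1l.
by rewrite -cstar_mulA (cstar_mulA (half_rotation b) (star _)) h2 cstar_mul1l.
Qed.

Lemma rotation_dist1 (b : A) : star b = b -> rn b <= 1 ->
  rn (e1 - rotation b) <= 2 * rn b.
Proof.
move=> bs b1; have [h1 _] := half_angle_unitary bs b1.
have bb1 : rn (b ** b) <= 1.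
  by rewrite rn_sqr_selfadjoint // expr_le1 ?rn_ge0.
have rr := sqrt1mE bb1; have rb := sqrt1m_comm bb1 (cstar_mulA b b b).
have n1 := rn_isometry h1; rewrite -/(half_rotation b) in n1.
have -> : e1 - rotation b = (- (2 * iC)) *: (b ** half_rotation b).
  rewrite /rotation /half_rotation; move: (sqrt1m _) rr rb => r rr rb.
  by rewrite !cmulE rr rb; lmod_eq R[i]; ring: (sqr_i R).
rewrite rnZ normcN normcM normc_i mulr1.
have -> : normc (2 : R[i]) = 2.
  by rewrite -(rmorph_nat (real_complex R)) normc_real ger0_norm.
rewrite ler_pM2l //; apply: le_trans (rn_cmul _ _) _.
by rewrite ler_piMr ?rn_ge0.
Qed.

(** The half rotation has eigenvalue z = k + i s on [u] and its inverse z' on [w], so its square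
    exchanges the two coefficients. *)
Lemma rep_rotation (b : A) (s k : R) (u w : H) (g : R[i]) :
  star b = b -> rn b <= 1 -> 0 < k -> k ^+ 2 + s ^+ 2 = 1 ->
  pi b u = s%:C *: u -> pi b w = - (s%:C *: w) ->
  let z := k%:C + iC * s%:C in let z' := k%:C - iC * s%:C in
  pi (rotation b) (g *: (z' *: u + z *: w)) = g *: (z *: u + z' *: w).
Proof.
move=> bs b1 k0 ks bu bw z z'.
have bb1 : rn (b ** b) <= 1.
  by rewrite rn_sqr_selfadjoint // expr_le1 ?rn_ge0.
have k2 : 1 - k ^+ 2 = s ^+ 2 by lra.
have ru : pi (sqrt1m (b ** b)) u = k%:C *: u.
  by apply: rep_sqrt1m => //; rewrite k2 repM !(bu, repE) rmorphXn; lmod.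
have rw : pi (sqrt1m (b ** b)) w = k%:C *: w.
  by apply: rep_sqrt1m => //; rewrite k2 repM !(bw, repE) rmorphXn; lmod.
have Vu : pi (half_rotation b) u = z *: u by rewrite repD repZ ru bu /z; lmod.
have Vw : pi (half_rotation b) w = z' *: w by rewrite repD repZ rw bw /z'; lmod.
have zz : z * z' = 1.
  rewrite -[RHS](rmorph1 (real_complex R)) -ks rmorphD !rmorphXn /z /z'.
  by ring: (sqr_i R).
clearbody z z'; rewrite /rotation repM !(repDv, repZv, Vu, Vw).
by congr (_ *: (_ + _)); rewrite !scalerA; congr (_ *: _);
  rewrite -[RHS]mulr1 -zz; ring.
Qed.

End transition.

(** * Convergence along filters in terms of the real-valued norm *)

Section filters.
Variable R : realType.

Lemma rn_cvgP (T : Type) (F : set_system T) {FF : Filter F}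
    (E : normedModType R[i]) (f : T -> E) (l : E) :
  f x @[x --> F] --> l <->
  (forall e : R, 0 < e -> \forall x \near F, rn (l - f x) < e).
Proof.
split=> [/cvgrPdist_lt h e e0|h].
  have := h e%:C; rewrite ltcR => /(_ e0); apply: filterS => x.
  by rewrite rnE ltcR.
apply/cvgrPdist_lt => e e0.
have e0' : 0 < complex.Re e by move: e0; rewrite ltcE => /andP[].
have eE : e = (complex.Re e)%:C.
  by move: e0; rewrite ltcE /=; case: (e) => a b /= /andP[/eqP -> _].
apply: filterS (h _ e0') => x; by rewrite rnE eE ltcR.
Qed.

Lemma cvg_cmul (A : unitalCStarType R) (T : Type) (F : set_system T)
    {FF : Filter F} (f g : T -> A) (l m : A) :
  f x @[x --> F] --> l -> g x @[x --> F] --> m ->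
  cstar_mul (f x) (g x) @[x --> F] --> cstar_mul l m.
Proof.
move=> /rn_cvgP hf /rn_cvgP hg; apply/rn_cvgP => e e0.
have K0 : 0 < rn l + rn m + 1.
  by rewrite ltr_wpDl // addr_ge0 ?rn_ge0.
pose r := Num.min 1 (e / (rn l + rn m + 1)).
have r0 : 0 < r by rewrite lt_min ltr01 divr_gt0.
have r1 : r <= 1 by rewrite ge_min lexx.
have rK : r * (rn l + rn m + 1) <= e.
  by rewrite -ler_pdivlMr // ge_min lexx orbT.
apply: filterS2 (hf _ r0) (hg _ r0) => x fx gx.
have -> : cstar_mul l m - cstar_mul (f x) (g x) =
    cstar_mul l (m - g x) + cstar_mul (l - f x) (m - (m - g x)).
  by rewrite !cmulE; lmod.
have := rnD (cstar_mul l (m - g x)) (cstar_mul (l - f x) (m - (m - g x))).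
have := rn_cmul l (m - g x); have := rn_cmul (l - f x) (m - (m - g x)).
have := rnB m (m - g x).
have := rn_ge0 l; have := rn_ge0 m; have := rn_ge0 (l - f x).
have := rn_ge0 (m - g x).
set a := rn (l - f x) in fx *; set b := rn (m - g x) in gx *.
set c := rn (m - (m - g x)) => b0 a0 m0 l0 cb h1 h2 h3.
have : rn l * b <= rn l * r by rewrite ler_wpM2l // ltW.
have : a * c <= a * (rn m + 1) by rewrite ler_wpM2l //; lra.
have : a * (rn m + 1) < r * (rn m + 1) by rewrite ltr_pM2r // ltr_wpDl.
lra.
Qed.

End filters.

(** * The eigenvectors of the rotation attached to a pair of unit vectors *)

Section frame.
Variables (R : realType) (H : hilbertType R).
Implicit Types (p : H * H) (x y : H).

Definition sqrt2 : R := Num.sqrt 2.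

Lemma sqrt2_gt0 : 0 < sqrt2.
Proof. by rewrite sqrtr_gt0. Qed.

Lemma sqrt2_sqr : sqrt2 ^+ 2 = 2.
Proof. by rewrite sqr_sqrtr. Qed.

Definition scaled_dir x : H := (sqrt2 * rn x)^-1%:C *: x.

(* With x, y orthogonal, these are the normalized eigenvectors of the rotation of
   the plane spanned by x and y. *)
Definition frame p : H * H :=
  (scaled_dir (p.1 + p.2) - iC *: scaled_dir (p.2 - p.1),
   scaled_dir (p.1 + p.2) + iC *: scaled_dir (p.2 - p.1)).

Lemma Yplus_unit p : Yplus H p -> rn p.1 = 1 /\ rn p.2 = 1.
Proof.
case; rewrite /unit_sphere /= !rnE => h1 h2 _.
by split; apply: (@complexI R); rewrite ?h1 ?h2 rmorph1.
Qed.

Lemma Yplus_inner p : Yplus H p -> exists2 t : R, 0 < t & inner p.1 p.2 = t%:C.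
Proof.
case=> _ _ /andP[]; rewrite ltcE => /andP[/eqP /= im re] _.
by exists (complex.Re (inner p.1 p.2)) => //; case: (inner _ _) im => a b /= ->.
Qed.

(** The parallelogram identity; positivity of the inner product makes the sum the longer
    diagonal. *)
Lemma Yplus_sum p : Yplus H p ->
  rn (p.1 + p.2) ^+ 2 + rn (p.2 - p.1) ^+ 2 = 4 /\ 2 < rn (p.1 + p.2) ^+ 2.
Proof.
move=> Yp; have [h1 h2] := Yplus_unit Yp; have [t t0 ht] := Yplus_inner Yp.
have rt : rinner p.1 p.2 = t by rewrite /rinner ht.
by rewrite rn_sqrD rn_sqrB h1 h2 (rinnerC p.2) rt; split; lra.
Qed.

Lemma frame_orthonormal p : Yplus H p -> p.1 <> p.2 ->
  orthonormal_pairs (frame p).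
Proof.
move=> Yp neq; have [h1 h2] := Yplus_unit Yp.
have [t t0 ht] := Yplus_inner Yp.
have [s1 s2] := Yplus_sum Yp.
rewrite /frame; set x := p.1 + p.2; set y := p.2 - p.1.
have xy : inner x y = 0 :> R[i].
  rewrite /x /y !innerE !inner_rn h1 h2 [inner p.2 p.1]innerC ht conjc_real; ring.
have x0 : 0 < rn x.
  by rewrite lt_def rn_ge0 andbT -sqrf_eq0 gt_eqF //; move: s2; rewrite -/x; lra.
have y0 : 0 < rn y by apply: rn_gt0 => /eqP; rewrite subr_eq0 => /eqP /esym.
have dir z : 0 < rn z -> inner (scaled_dir z) (scaled_dir z) = 2^-1 :> R[i].
  move=> z0; rewrite innerZl innerZr conjc_real inner_rn -!rmorphM /=.
  have -> : (sqrt2 * rn z)^-1 * ((sqrt2 * rn z)^-1 * rn z ^+ 2) = 2^-1.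
    rewrite -sqrt2_sqr; field; rewrite !gt_eqF ?sqrt2_gt0 //.
  by rewrite rmorphV ?unitfE // rmorph_nat.
have dxy : inner (scaled_dir x) (scaled_dir y) = 0 :> R[i].
  by rewrite innerZl innerZr xy !mulr0.
have dyx : inner (scaled_dir y) (scaled_dir x) = 0 :> R[i].
  by rewrite innerC dxy conjc0.
have dxx := dir _ x0; have dyy := dir _ y0.
move: (scaled_dir x) (scaled_dir y) dxy dyx dxx dyy => a b ab ba aa bb.
have unit (z : H) : inner z z = 1 :> R[i] -> rn z = 1.
  rewrite inner_rn => /eqP; rewrite -(rmorph1 (real_complex R)).
  by move=> /eqP /(@complexI R) /eqP; rewrite sqrp_eq1 ?rn_ge0 // => /eqP.
have ci : conjc (iC : R[i]) = - iC by rewrite conjc_i.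
split=> /=.
- apply: unit; rewrite !innerE ci ab ba aa bb.
  by field: (sqr_i R).
- apply: unit; rewrite !innerE ci ab ba aa bb.
  by field: (sqr_i R).
- rewrite !innerE ci ab ba aa bb.
  by field: (sqr_i R).
Qed.

(** Here k and s are the cosine and sine of half the angle between the two vectors, and the
    coefficients match those of [rep_rotation]. *)
Lemma frame_reconstruct p : Yplus H p -> p.1 <> p.2 ->
  let k := (rn (p.1 + p.2) / 2)%:C in let s := (rn (p.2 - p.1) / 2)%:C in
  let z := k + iC * s in let z' := k - iC * s in
  p.1 = sqrt2^-1%:C *: (z' *: (frame p).1 + z *: (frame p).2) /\
  p.2 = sqrt2^-1%:C *: (z *: (frame p).1 + z' *: (frame p).2).
Proof.
move=> Yp neq /=; have [s1 s2] := Yplus_sum Yp.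
set x := p.1 + p.2 in s1 s2 *; set y := p.2 - p.1 in s1 *.
have x0 : 0 < rn x.
  by rewrite lt_def rn_ge0 andbT -sqrf_eq0 gt_eqF //; lra.
have y0 : 0 < rn y by apply: rn_gt0 => /eqP; rewrite subr_eq0 => /eqP /esym.
have dir u : 0 < rn u ->
    (sqrt2^-1 * rn u)%:C *: scaled_dir u = 2^-1 *: u.
  move=> u0; rewrite /scaled_dir scalerA -rmorphM /=.
  have -> : sqrt2^-1 * rn u * (sqrt2 * rn u)^-1 = (sqrt2 ^+ 2)^-1.
    by field; rewrite !gt_eqF ?sqrt2_gt0.
  by rewrite sqrt2_sqr rmorphV ?unitfE // rmorph_nat.
have dx := dir _ x0; have dy := dir _ y0.
have two : (2^-1 : R)%:C = 2^-1 :> R[i].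
  by rewrite rmorphV ?unitfE // rmorph_nat.
have p1E : p.1 = 2^-1 *: x - 2^-1 *: y by rewrite /x /y; lmod.
have p2E : p.2 = 2^-1 *: x + 2^-1 *: y by rewrite /x /y; lmod.
rewrite -dx -dy in p1E p2E; rewrite /frame -/x -/y /=.
rewrite [X in X = _ /\ _]p1E [X in _ /\ X = _]p2E.
move: (scaled_dir x) (scaled_dir y) => a b.
rewrite !rmorphM /= two; move: (sqrt2^-1)%:C => g.
by split; lmod_eq R[i]; field: (sqr_i R).
Qed.

End frame.

(** * The transition unitaries and their continuity *)

Section main.
Variables (R : realType) (A : unitalCStarType R) (H : hilbertType R).
Variable pi : representation A H.
Hypothesis pi_nonzero : nonzero_rep pi.
Hypothesis pi_irreducible : irreducible_rep pi.
Variable c : H * H -> A.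
Hypothesis cP : forall p, orthonormal_pairs p ->
  [/\ star (c p) = c p, pi (c p) p.1 = p.1 & pi (c p) p.2 = - p.2].
Hypothesis c_cont : eps_continuous c.

Definition generator (p : H * H) : A :=
  (rn (p.2 - p.1) / 2)%:C *: clamp (c (frame p)).

(** The diagonal is treated apart because the frame degenerates there. *)
Definition transition (p : H * H) : A :=
  if p.1 == p.2 then cstar_one else rotation (generator p).

Lemma generator_star p : star (generator p) = generator p.
Proof. by rewrite /generator starZc conjc_real clamp_star. Qed.

Lemma rn_generator p : Yplus H p -> p.1 <> p.2 ->
  rn (generator p) <= rn (p.2 - p.1) / 2.
Proof.
move=> Yp neq; have [cs _ _] := cP (frame_orthonormal Yp neq).
have h : 0 <= rn (p.2 - p.1) / 2 by rewrite divr_ge0 ?rn_ge0.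
by rewrite rnZ normc_real ger0_norm // ler_piMr // rn_clamp.
Qed.

(** The bound 1/2 puts squares of generators in the ball where [sqrt1m] is Lipschitz. *)
Lemma dist_half_lt1 p : Yplus H p -> (rn (p.2 - p.1) / 2) ^+ 2 <= 1 / 2.
Proof. by move=> /Yplus_sum[h1 h2]; rewrite exprMn exprVn; lra. Qed.

Lemma generator_le1 p : Yplus H p -> p.1 <> p.2 -> rn (generator p) <= 1.
Proof.
move=> Yp neq; apply: le_trans (rn_generator Yp neq) _.
have := dist_half_lt1 Yp; have := rn_ge0 (p.2 - p.1).
move: (rn _) => x; nra.
Qed.

Lemma transition_unitary p : Yplus H p -> unitary_group A (transition p).
Proof.
move=> Yp; rewrite /transition; case: eqP => neq.
  by rewrite /unitary_group /= star1 cstar_mul1l.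
by apply: rotation_unitary; [exact: generator_star | exact: generator_le1].
Qed.

Lemma transition_maps p : Yplus H p -> pi (transition p) p.1 = p.2.
Proof.
move=> Yp; rewrite /transition; case: eqP => neq; first by rewrite rep_one.
have fo := frame_orthonormal Yp neq.
have [cs c1 c2] := cP fo.
(* For an exact eigenvector the error bound of [rep_clamp] is zero. *)
have clamp_eig (l : R) (v : H) : 2 * l / (1 + l ^+ 2) = l ->
    pi (c (frame p)) v = l%:C *: v -> pi (clamp (c (frame p))) v = l%:C *: v.
  move=> ll cv; apply: rn_le_eps => e e0.
  have := rep_clamp pi_nonzero pi_irreducible l v cs.
  by rewrite cv subrr rn0 mulr0 ll => h; apply: le_lt_trans e0.
have gu : pi (generator p) (frame p).1 = (rn (p.2 - p.1) / 2)%:C *: (frame p).1.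
  rewrite repZ (clamp_eig 1) ?rmorph1 ?scale1r //.
  by rewrite expr1n mulr1 divff.
have gw : pi (generator p) (frame p).2 = - ((rn (p.2 - p.1) / 2)%:C *: (frame p).2).
  rewrite repZ (clamp_eig (-1)) ?rmorphN ?rmorph1 ?scaleN1r ?scalerN //.
  by rewrite sqrrN expr1n mulrN1 mulNr divff.
have [s1 s2] := Yplus_sum Yp.
have k0 : 0 < rn (p.1 + p.2) / 2.
  rewrite divr_gt0 // lt_def rn_ge0 andbT -sqrf_eq0 gt_eqF //; lra.
have ks : (rn (p.1 + p.2) / 2) ^+ 2 + (rn (p.2 - p.1) / 2) ^+ 2 = 1.
  by rewrite !exprMn !exprVn; lra.
have /= rot := rep_rotation pi_nonzero pi_irreducible (sqrt2 R)^-1%:C (generator_star p)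
  (generator_le1 Yp neq) k0 ks gu gw.
have /= [p1E p2E] := frame_reconstruct Yp neq.
by rewrite [X in pi _ X]p1E rot -p2E.
Qed.

(** The upper bound comes from [rotation_dist1]; the lower one from applying 1 - U to the unit
    vector [p.1], which gives p.1 - p.2. *)
Lemma transition_dist1 p : Yplus H p ->
  rn (cstar_one - transition p) = rn (p.1 - p.2).
Proof.
move=> Yp; apply/eqP; rewrite eq_le; apply/andP; split.
  rewrite /transition; case: eqP => [->|neq]; first by rewrite !subrr !rn0.
  have := rotation_dist1 (generator_star p) (generator_le1 Yp neq).
  by have := rn_generator Yp neq; rewrite (rn_dist p.1); lra.
have [h1 _] := Yplus_unit Yp.
have := rep_contraction pi_nonzero pi_irreducible (cstar_one - transition p) p.1.
by rewrite repB rep_one // transition_maps // h1 mulr1.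
Qed.

Section continuity.
Variables (F : set_system (H * H)) (p0 : H * H).
Context {FF : Filter F}.
Hypothesis FY : F (Yplus H).
Hypothesis Yp0 : Yplus H p0.
Hypothesis neq0 : p0.1 <> p0.2.
Hypothesis F1 : p.1 @[p --> F] --> p0.1.
Hypothesis F2 : p.2 @[p --> F] --> p0.2.

Lemma near_off_diagonal : \forall p \near F, p.1 <> p.2.
Proof.
have d0 : 0 < rn (p0.1 - p0.2) by apply: rn_gt0 => /eqP; rewrite subr_eq0 => /eqP.
have d2 : 0 < rn (p0.1 - p0.2) / 2 by lra.
have /rn_cvgP/(_ _ d2) h1 := F1; have /rn_cvgP/(_ _ d2) h2 := F2.
apply: filterS2 h1 h2 => p h1 h2 e.
have := rn_dist_trans p.1 p0.1 p0.2; rewrite {2}e (rn_dist p.2); lra.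
Qed.

Lemma cvg_scaled_dir (f : H * H -> H) (l : H) : l <> 0 ->
  f p @[p --> F] --> l -> scaled_dir (f p) @[p --> F] --> scaled_dir l.
Proof.
move=> l0 fl.
have E x : scaled_dir x = ((sqrt2 R)%:C * `|x|)^-1 *: x.
  by rewrite /scaled_dir rnE -rmorphM fmorphV.
rewrite E; under eq_fun do rewrite E.
apply: cvgZ => //; apply: cvgV.
  rewrite rnE -rmorphM (fmorph_eq0 (real_complex R)) mulf_neq0 ?gt_eqF ?sqrt2_gt0 //.
  exact: rn_gt0.
by apply: cvgM; [exact: cvg_cst | exact: cvg_norm].
Qed.

Lemma cvg_sum : p.1 + p.2 @[p --> F] --> p0.1 + p0.2.
Proof. exact: cvgD. Qed.

Lemma cvg_diff : p.2 - p.1 @[p --> F] --> p0.2 - p0.1.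
Proof. exact: cvgB. Qed.

Lemma cvg_frame : (frame p).1 @[p --> F] --> (frame p0).1 /\
  (frame p).2 @[p --> F] --> (frame p0).2.
Proof.
have sum0 : p0.1 + p0.2 <> 0.
  move=> e; have [_] := Yplus_sum Yp0; rewrite e rn0; lra.
have diff0 : p0.2 - p0.1 <> 0.
  by move=> /eqP; rewrite subr_eq0 => /eqP /esym.
have hs := cvg_scaled_dir sum0 cvg_sum; have hd := cvg_scaled_dir diff0 cvg_diff.
have hi : iC *: scaled_dir (p.2 - p.1) @[p --> F] --> iC *: scaled_dir (p0.2 - p0.1).
  by apply: cvgZ => //; exact: cvg_cst.
by split; [apply: cvgB | apply: cvgD].
Qed.

Lemma cvg_clamp : clamp (c (frame p)) @[p --> F] --> clamp (c (frame p0)).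
Proof.
have [/rn_cvgP f1 /rn_cvgP f2] := cvg_frame.
have fo := frame_orthonormal Yp0 neq0; have [cs _ _] := cP fo.
apply/rn_cvgP => e e0; have e2 : 0 < e / 2 by lra.
have [r r0 hr] := c_cont fo e2; have r2 : 0 < r / 2 by lra.
apply: filterS3 (filterI (f1 _ r2) (f2 _ r2)) FY near_off_diagonal.
move=> p [h1 h2] Yp neq.
have fp := frame_orthonormal Yp neq; have [cs' _ _] := cP fp.
have := clamp_lipschitz cs cs'; have := hr _ fp.
have : pair_dist (frame p0) (frame p) < r by rewrite /pair_dist; lra.
by move=> h /(_ h); lra.
Qed.

Lemma cvg_generator : generator p @[p --> F] --> generator p0.
Proof.
have E p : generator p = (2^-1 * `|p.2 - p.1|) *: clamp (c (frame p)).
  rewrite /generator rnE rmorphM mulrC; congr (_ * _ *: _).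
  by rewrite fmorphV rmorph_nat.
rewrite E; under eq_fun do rewrite E.
apply: cvgZ; last exact: cvg_clamp.
by apply: cvgM; [exact: cvg_cst | apply: cvg_norm; exact: cvg_diff].
Qed.

Lemma cvg_transition : transition p @[p --> F] --> transition p0.
Proof.
have hb := cvg_generator; have hbb := cvg_cmul (FF := FF) hb hb.
have small p : Yplus H p -> p.1 <> p.2 ->
    rn (cstar_mul (generator p) (generator p)) <= 1 / 2.
  move=> Yp neq; rewrite rn_sqr_selfadjoint ?generator_star //.
  apply: le_trans (dist_half_lt1 Yp); rewrite ler_pXn2r ?nnegrE ?rn_ge0 //.
    exact: rn_generator.
  by rewrite divr_ge0 ?rn_ge0.
have hr : sqrt1m (cstar_mul (generator p) (generator p)) @[p --> F] -->
    sqrt1m (cstar_mul (generator p0) (generator p0)).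
  apply/rn_cvgP => e e0; have /rn_cvgP/(_ _ e0) h := hbb.
  apply: filterS3 h FY near_off_diagonal => p h Yp neq.
  by apply: le_lt_trans h; apply: sqrt1m_lipschitz; exact: small.
have hV : half_rotation (generator p) @[p --> F] --> half_rotation (generator p0).
  by apply: cvgD => //; apply: cvgZ => //; exact: cvg_cst.
have hU := cvg_cmul (FF := FF) hV hV.
have t0 : transition p0 = rotation (generator p0) by rewrite /transition; case: eqP.
rewrite t0; apply/rn_cvgP => e e0; have /rn_cvgP/(_ _ e0) h := hU.
apply: filterS2 h near_off_diagonal => p h neq.
by rewrite /transition; case: eqP.
Qed.

End continuity.

(** Off the diagonal every ingredient is continuous; at a diagonal point the distance of U to 1
    equals |p.1 - p.2|, which tends to 0. *)
Lemma transition_continuous : {within Yplus H, continuous transition}.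
Proof.
apply/subspace_continuousP => p0 Yp0.
have FY : within (Yplus H) (nbhs p0) (Yplus H).
  by rewrite /within /=; apply: filterS filterT => x.
have F1 : p.1 @[p --> within (Yplus H) (nbhs p0)] --> p0.1.
  by apply: cvg_within_filter; exact: cvg_fst.
have F2 : p.2 @[p --> within (Yplus H) (nbhs p0)] --> p0.2.
  by apply: cvg_within_filter; exact: cvg_snd.
have [e|/eqP neq] := eqVneq p0.1 p0.2; last exact: cvg_transition.
have t0 : transition p0 = cstar_one by rewrite /transition e eqxx.
rewrite /from_subspace t0; apply/rn_cvgP => d d0; have d2 : 0 < d / 2 by lra.
have /rn_cvgP/(_ _ d2) h1 := F1; have /rn_cvgP/(_ _ d2) h2 := F2.
apply: filterS3 h1 h2 FY => p h1 h2 Yp; rewrite transition_dist1 //.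
have := rn_dist_trans p0.1 p.1 p.2; rewrite {2}e (rn_dist p.1 p0.1); lra.
Qed.

End main.

Theorem theorem3p4 (R : realType) (A : unitalCStarType R) (H : hilbertType R)
    (pi : representation A H)
    (pi_nonzero : nonzero_rep pi) (pi_irreducible : irreducible_rep pi) :
  exists U : H * H -> A,
    [/\ {within Yplus H, continuous U},
        set_fun (Yplus H) (unitary_group A) U &
        forall Psi Omega : H, Yplus H (Psi, Omega) ->
          pi (U (Psi, Omega)) Psi = Omega /\
          `|cstar_one - U (Psi, Omega)| = `|Psi - Omega| ].
Proof.
have [c [cP c_cont]] := reflection_selection pi_nonzero pi_irreducible.
exists (transition c); split.
- exact: (transition_continuous pi_nonzero pi_irreducible cP c_cont).
- by move=> p Yp; exact: (transition_unitary cP).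
move=> Psi Omega Yp; split.
  exact: (transition_maps pi_nonzero pi_irreducible cP Yp).
by rewrite !rnE (transition_dist1 pi_nonzero pi_irreducible cP Yp).
Qed.
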